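(* Let $\mathfrak g=\mathfrak g_2$ over $\mathbb C$, $\mathfrak n$ its maximal nilpotent subalgebra, and $\mathfrak l_\bullet=\Pi(H^{\bullet+1}(\mathfrak n;\mathfrak n))$. An odd element $x\in\mathfrak l_\bullet$, i.e. $x=x^0+x^2+x^4+x^6$ with $x^i=\sum_jk^i_jh^i_j\in H^i(\mathfrak n;\mathfrak n)$, is homologic (that is, $[x,x]=0$) if and only if one of the following holds. a) $x^0=0$ and $x=y+z$, where $y\in\mathrm{Span}(h^2_4,h^2_6,h^4_2,h^4_3,h^4_5,h^4_6,h^4_7,h^6_1,h^6_2)$ and $z$ is of one of the following forms (with arbitrary complex coefficients unless a condition is stated): - $k^2_1h^2_1+k^2_5h^2_5+k^4_1h^4_1+k^4_4h^4_4$ with $k^2_1k^4_4+k^2_5k^4_1=0$; - $k^2_2h^2_2+k^4_1h^4_1$; - $k^2_2h^2_2+k^2_7h^2_7$; - $k^2_3h^2_3+k^2_7h^2_7$; - $k^2_1h^2_1+k^2_3h^2_3+k^4_1h^4_1$; - $k^2_5h^2_5+k^2_7h^2_7+k^4_4h^4_4$. b) $x^0\neq0$ and $x=y+z$, where $y\in\mathrm{Span}(h^2_4,h^2_6,h^4_2,h^4_6,h^4_7,h^6_1,h^6_2)$ and $z$ is of one of the following forms, with $\alpha\neq0$ and $\beta,\gamma\in\mathbb C$ arbitrary: - $\alpha h^0_1+\beta h^2_2+\gamma\bigl(h^2_3+540\frac{\beta}{\alpha}h^4_3\bigr)$; - $\alpha h^0_1+\beta h^2_2+\gamma\bigl(h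^2_5-108\frac{\beta}{\alpha}h^4_5\bigr)$.
   Context: The algebra $\mathfrak n$ is 6-dimensional with basis $e_{0,1},e_{1,0},e_{1,1},e_{1,2},e_{1,3},e_{2,3}$, where $e_{p,q}$ is the root vector (from a Chevalley basis) of the positive root with coordinates $(p,q)$ in the simple roots; $f^{p,q}$ is the dual basis of $\mathfrak n^*$. The nonzero brackets of basis vectors are (up to antisymmetry) $[e_{0,1},e_{1,0}]=e_{1,1}$, $[e_{0,1},e_{1,1}]=2e_{1,2}$, $[e_{0,1},e_{1,2}]=3e_{1,3}$, $[e_{1,0},e_{1,3}]=e_{2,3}$, $[e_{1,1},e_{1,2}]=-3e_{2,3}$. $C^k=\mathfrak n\otimes\Lambda^k\mathfrak n^*$ are the cochains with adjoint coefficients, with the Chevalley–Eilenberg differential; $H^k=H^k(\mathfrak n;\mathfrak n)$. Cocycles are identified with their classes. For monomials $a=e_\alpha\otimes f^{\beta_1}\wedge\dots\wedge f^{\beta_p}$, $b=e_{\alpha'}\otimes f^{\beta'_1}\wedge\dots\wedge f^{\beta'_q}$ put $$a\cdot b=\sum_{k=1}^{p}(-1)^{p-k}f^{\beta_k}(e_{\alpha'})\,e_\alpha\otimes f^{\beta_1}\wedge\dots\wedge\widehat{f^{\beta_k}}\wedge\dots\wedge f^{\beta_p}\wedge f^{\beta'_1}\wedge\dots\wedge f^{\beta'_q},$$ extended bilinearly, and $[a,b]=a\cdot b-(-1)^{(p-1)(q-1)}b\cdot a$. This makes $\Pi(C^{\bullet+1})$ ($\Pi$ is the change of parity; $C^{k+1}$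 sits in degree $k$ with parity $k\bmod2$) a differential graded Lie superalgebra and induces a Lie superalgebra structure on $\mathfrak l_\bullet$, $\mathfrak l_k=\Pi(H^{k+1})$; its odd part is $H^0\oplus H^2\oplus H^4\oplus H^6$. Write $e_{pq}[r_1s_1,\dots,r_ks_k]$ for $e_{p,q}\otimes f^{r_1,s_1}\wedge\dots\wedge f^{r_k,s_k}$. Bases of $H^0,H^2,H^4,H^6$ are given by the classes of the following cocycles. $h^0_1=e_{23}$. $h^2_1=-e_{01}[10,11]+e_{13}[10,23]$; $h^2_2=-68e_{01}[01,11]+216e_{10}[10,11]+74e_{11}[10,12]+39e_{12}[10,13]+31e_{12}[11,12]-9e_{13}[01,23]+108e_{13}[11,13]+9e_{23}[11,23]$; $h^2_3=-e_{01}[01,10]+e_{11}[10,11]+2e_{12}[10,12]+3e_{13}[10,13]+3e_{23}[10,23]$; $h^2_4=e_{13}[10,11]$; $h^2_5=e_{10}[01,13]$; $h^2_6=11e_{10}[01,11]+14e_{11}[01,12]+9e_{12}[01,13]+8e_{23}[12,13]$; $h^2_7=e_{10}[01,10]+e_{11}[01,11]+e_{12}[01,12]+e_{13}[01,13]+2e_{23}[01,23]$. $h^4_1=e_{01}[10,11,12,23]$; $h^4_2=-4e_{01}[01,10,12,23]+35e_{01}[10,11,12,13]-31e_{11}[10,11,12,23]-18e_{12}[10,11,13,23]-27e_{13}[10,12,13,23]$; $h^4_3=e_{01}[01,10,11,23]+e_{12}[10,11,12,23]+2e_{13}[10,11,13,23]$; $h^4_4=e_{10}[01,12,13,23]$;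 $h^4_5=e_{10}[01,11,13,23]+2e_{11}[01,12,13,23]$; $h^4_6=11e_{01}[01,11,12,13]-4e_{10}[01,10,12,23]-4e_{10}[10,11,12,13]-7e_{11}[01,11,12,23]-9e_{12}[01,11,13,23]-5e_{13}[01,12,13,23]+e_{23}[11,12,13,23]$; $h^4_7=e_{10}[01,10,12,13]+e_{11}[01,11,12,13]+e_{23}[01,12,13,23]$. $h^6_1=e_{01}[01,10,11,12,13,23]$; $h^6_2=e_{10}[01,10,11,12,13,23]$. *)

(* Defs.v *)
From mathcomp Require Import all_boot all_order all_algebra.
From mathcomp Require Import reals complex.

Set Implicit Arguments.
Unset Strict Implicit.
Unset Printing Implicit Defensive.

Import GRing.Theory.
Local Open Scope ring_scope.

(* ipq is the index of the root vector e_{p,q}, and of its dual f^{p,q}. *)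
Definition i01 : 'I_6 := @Ordinal 6 0 isT.
Definition i10 : 'I_6 := @Ordinal 6 1 isT.
Definition i11 : 'I_6 := @Ordinal 6 2 isT.
Definition i12 : 'I_6 := @Ordinal 6 3 isT.
Definition i13 : 'I_6 := @Ordinal 6 4 isT.
Definition i23 : 'I_6 := @Ordinal 6 5 isT.

(* Vectors of n are row vectors of coordinates in the basis (e_{p,q}). *)
Definition evec {K : fieldType} (a : 'I_6) : 'rV[K]_6 := delta_mx 0 a.

(* The bracket of the maximal nilpotent subalgebra n of g_2: m i j is the value
   of the 2-form f^i /\ f^j on (u, v), and each summand is one of the nonzero
   brackets [e_i, e_j], i < j. *)
Definition lie {K : fieldType} (u v : 'rV[K]_6) : 'rV[K]_6 :=
  let m i j := u 0 i * v 0 j - u 0 j * v 0 i in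
  m i01 i10 *: evec i11
  + m i01 i11 *: (2 *: evec i12)
  + m i01 i12 *: (3 *: evec i13)
  + m i10 i13 *: evec i23
  + m i11 i12 *: (- 3 *: evec i23).

(* The whole complex n (x) Lambda n^*: a cochain c is recorded by its values
   c S = c(e_{s_1}, ..., e_{s_k}) in n, for S = {s_1 < ... < s_k}.  It has
   degree k when it is supported on the sets of cardinality k. *)
Notation cochain K := {ffun {set 'I_6} -> 'rV[K]_6}.

Fixpoint inversions (s : seq 'I_6) : nat :=
  if s is x :: s' then (count (fun y : 'I_6 => (y < x)%N) s' + inversions s')%N
  else 0%N.

(* Sign of the permutation sorting s, and 0 if s has a repetition. *)
Definition sgn {K : fieldType} (s : seq 'I_6) : K :=
  if uniq s then (-1) ^+ inversions s else 0.

(* mono a [:: b_1; ...; b_k] = e_a (x) f^{b_1} /\ ... /\ f^{b_k}. *)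
Definition mono {K : fieldType} (a : 'I_6) (s : seq 'I_6) : cochain K :=
  [ffun S => if S == [set:: s] then sgn s *: evec a else 0].

(* The value c(e_{s_1}, ..., e_{s_k}) for an arbitrary sequence of indices. *)
Definition ceval {K : fieldType} (c : cochain K) (s : seq 'I_6) : 'rV[K]_6 :=
  sgn s *: c [set:: s].

(* Chevalley-Eilenberg differential with adjoint coefficients, evaluated on
   basis vectors:
     (dc)(x_1, ..., x_{k+1})
       = sum_i (-1)^(i+1) [x_i, c(..., ^x_i, ...)]
       + sum_(i < j) (-1)^(i+j) c([x_i, x_j], ..., ^x_i, ..., ^x_j, ...).
   Positions are counted from 0 by index, which changes (-1)^(i+1) into (-1)^i
   and leaves (-1)^(i+j) unchanged; enum S is increasing. *)
Definition diff {K : fieldType} (c : cochain K) : cochain K :=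
  [ffun S : {set 'I_6} =>
    \sum_(x in S) (-1) ^+ index x (enum S) *: lie (evec x) (c (S :\ x))
    + \sum_(y in S) \sum_(x in S | (x < y)%N)
        (-1) ^+ (index x (enum S) + index y (enum S)) *:
        \sum_(m < 6) lie (evec x) (evec y) 0 m *: ceval c (m :: enum (S :\ x :\ y))].

Definition cocycle {K : fieldType} (c : cochain K) : Prop := diff c = 0.

Definition coboundary {K : fieldType} (c : cochain K) : Prop :=
  exists b : cochain K, c = diff b.

(* Equality of classes in H(n; n). *)
Definition cohomologous {K : fieldType} (c c' : cochain K) : Prop :=
  coboundary (c - c').

Definition hcomp {K : fieldType} (k : nat) (c : cochain K) : cochain K :=
  [ffun S : {set 'I_6} => if #|S| == k then c S else 0].

(* l_k is Pi(H^{k+1}), so the odd elements of l are the classes of the cocycles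
   all of whose components have even cochain degree. *)
Definition odd_elt {K : fieldType} (c : cochain K) : Prop :=
  cocycle c /\ forall k, odd k -> hcomp k c = 0.

(* The product a . b of the monomials a = e_a (x) f^{s_1} /\ ... /\ f^{s_p} and
   b = e_b (x) f^{t_1} /\ ... /\ f^{t_q}; positions in s are counted from 0. *)
Definition dot_mono {K : fieldType} (a : 'I_6) (s : seq 'I_6)
    (b : 'I_6) (t : seq 'I_6) : cochain K :=
  \sum_(k < size s)
    ((-1) ^+ (size s - k.+1) * evec b 0 (nth i01 s k)) *:
    mono a (take k s ++ drop k.+1 s ++ t).

Definition dot {K : fieldType} (c c' : cochain K) : cochain K :=
  \sum_(S : {set 'I_6}) \sum_(a < 6) \sum_(T : {set 'I_6}) \sum_(b < 6)
    (c S 0 a * c' T 0 b) *: dot_mono a (enum S) b (enum T).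

(* [a, b] = a . b - (-1)^((p-1)(q-1)) b . a for a in C^p and b in C^q, extended
   by bilinearity.  The exponent is written (p+1)(q+1), which has the same
   parity, because p and q may be 0. *)
Definition bracket {K : fieldType} (c c' : cochain K) : cochain K :=
  \sum_(p < 7) \sum_(q < 7)
    (dot (hcomp p c) (hcomp q c')
     - (-1) ^+ (p.+1 * q.+1) *: dot (hcomp q c') (hcomp p c)).

(* For x representing an odd element of l, [x, x] = 0 in l. *)
Definition homologic {K : fieldType} (x : cochain K) : Prop :=
  coboundary (bracket x x).

Definition h0_1 {K : fieldType} : cochain K :=
  mono i23 [::].

Definition h2_1 {K : fieldType} : cochain K :=
  - mono i01 [:: i10; i11]
  + mono i13 [:: i10; i23].

Definition h2_2 {K : fieldType} : cochain K :=
  - (68 *: mono i01 [:: i01; i11])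
  + 216 *: mono i10 [:: i10; i11]
  + 74 *: mono i11 [:: i10; i12]
  + 39 *: mono i12 [:: i10; i13]
  + 31 *: mono i12 [:: i11; i12]
  - 9 *: mono i13 [:: i01; i23]
  + 108 *: mono i13 [:: i11; i13]
  + 9 *: mono i23 [:: i11; i23].

Definition h2_3 {K : fieldType} : cochain K :=
  - mono i01 [:: i01; i10]
  + mono i11 [:: i10; i11]
  + 2 *: mono i12 [:: i10; i12]
  + 3 *: mono i13 [:: i10; i13]
  + 3 *: mono i23 [:: i10; i23].

Definition h2_4 {K : fieldType} : cochain K :=
  mono i13 [:: i10; i11].

Definition h2_5 {K : fieldType} : cochain K :=
  mono i10 [:: i01; i13].

Definition h2_6 {K : fieldType} : cochain K :=
  11 *: mono i10 [:: i01; i11]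
  + 14 *: mono i11 [:: i01; i12]
  + 9 *: mono i12 [:: i01; i13]
  + 8 *: mono i23 [:: i12; i13].

Definition h2_7 {K : fieldType} : cochain K :=
  mono i10 [:: i01; i10]
  + mono i11 [:: i01; i11]
  + mono i12 [:: i01; i12]
  + mono i13 [:: i01; i13]
  + 2 *: mono i23 [:: i01; i23].

Definition h4_1 {K : fieldType} : cochain K :=
  mono i01 [:: i10; i11; i12; i23].

Definition h4_2 {K : fieldType} : cochain K :=
  - (4 *: mono i01 [:: i01; i10; i12; i23])
  + 35 *: mono i01 [:: i10; i11; i12; i13]
  - 31 *: mono i11 [:: i10; i11; i12; i23]
  - 18 *: mono i12 [:: i10; i11; i13; i23]
  - 27 *: mono i13 [:: i10; i12; i13; i23].

Definition h4_3 {K : fieldType} : cochain K :=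
  mono i01 [:: i01; i10; i11; i23]
  + mono i12 [:: i10; i11; i12; i23]
  + 2 *: mono i13 [:: i10; i11; i13; i23].

Definition h4_4 {K : fieldType} : cochain K :=
  mono i10 [:: i01; i12; i13; i23].

Definition h4_5 {K : fieldType} : cochain K :=
  mono i10 [:: i01; i11; i13; i23]
  + 2 *: mono i11 [:: i01; i12; i13; i23].

Definition h4_6 {K : fieldType} : cochain K :=
  11 *: mono i01 [:: i01; i11; i12; i13]
  - 4 *: mono i10 [:: i01; i10; i12; i23]
  - 4 *: mono i10 [:: i10; i11; i12; i13]
  - 7 *: mono i11 [:: i01; i11; i12; i23]
  - 9 *: mono i12 [:: i01; i11; i13; i23]
  - 5 *: mono i13 [:: i01; i12; i13; i23]
  + mono i23 [:: i11; i12; i13; i23].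

Definition h4_7 {K : fieldType} : cochain K :=
  mono i10 [:: i01; i10; i12; i13]
  + mono i11 [:: i01; i11; i12; i13]
  + mono i23 [:: i01; i12; i13; i23].

Definition h6_1 {K : fieldType} : cochain K :=
  mono i01 [:: i01; i10; i11; i12; i13; i23].

Definition h6_2 {K : fieldType} : cochain K :=
  mono i10 [:: i01; i10; i11; i12; i13; i23].

(* Main.v *)
From HB Require Import structures.
From Stdlib Require Import ZArith QArith.
Require Import Defs.
From mathcomp Require Import all_boot all_order all_algebra.
From mathcomp Require Import reals complex ssrZ ring.

Set Implicit Arguments.
Unset Strict Implicit.
Unset Printing Implicit Defensive.

Import Order.TTheory GRing.Theory Num.Theory.
Local Open Scope ring_scope.

(** The bracket descends to cohomology, so for an even-degree cocycle x the
    condition [x, x] = 0 depends only on the coordinates k_j of the class of x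
    in the basis h_j of H^0 + H^2 + H^4 + H^6, and it is a system of quadratic
    equations in the k_j.  The multiplication table of the h_j (quadrics) shows
    that the system consists of twelve equations, listed in equations; solving
    it case by case gives the two families of the theorem.

    Four facts carry this.  The differential is a derivation of the bracket
    (leibniz), so replacing x by a cohomologous cocycle changes [x, x] by a
    coboundary (square_harm).  The h_j span the even cohomology: a linear map
    prim, found by Gaussian elimination, inverts the differential on
    coboundaries, and every even cocycle is the sum of its harmonic part
    harm x = sum_j phi_j(x) h_j and of a coboundary (hodge).  The coordinates
    are given by explicit linear forms phi_j which vanish on coboundaries and
    satisfy phi_i(h_j) = delta_ij (phi_diff, phi_cls), so they are invariants
    of the class.  Finally every [h_i, h_j] is, up to a coboundary, a
    combination of twelve cocycles on which linear forms psi_m vanishing on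
    coboundaries form a dual system (square_class, psi_square); hence [x, x] is
    a coboundary if and only if all psi_m([x, x]) vanish (homologicP).

    All these are linear or bilinear identities on a space with a basis of
    384 monomials e_a (x) f^S, with rational coefficients, so they hold over
    any field of characteristic 0 once they are checked on monomials.  The
    checks are evaluated on lists of rational multiples of monomials, which
    interp maps to cochains compatibly with the differential (interp_diff) and
    the product (interp_dot). *)

(** * Index sequences *)

Definition ords : seq 'I_6 := [:: i01; i10; i11; i12; i13; i23].

Lemma enum_ords : enum 'I_6 = ords.
Proof. by apply: (inj_map val_inj); rewrite val_enum_ord. Qed.

Lemma mem_ords i : i \in ords.
Proof. by rewrite -enum_ords mem_enum. Qed.

(** The generic equality is unfolded to recursion on numbers, because the
    finite checks below evaluate it several million times. *)
Definition same (i j : 'I_6) : bool := eqn i j.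

Lemma sameE i j : same i j = (i == j).
Proof. by []. Qed.

Fixpoint same_seq (s t : seq 'I_6) : bool :=
  match s, t with
  | [::], [::] => true
  | i :: s', j :: t' => if same i j then same_seq s' t' else false
  | _, _ => false
  end.

Lemma same_seqE s t : same_seq s t = (s == t).
Proof. by elim: s t => [|i s IH] [|j t] //=; rewrite IH sameE eqseq_cons; case: eqP. Qed.

(** The increasing rearrangement of a sequence without repetition. *)
Definition canon (s : seq 'I_6) : seq 'I_6 := [seq i <- ords | has (same i) s].

Definition subs : seq (seq 'I_6) :=
  foldr (fun i r => [seq i :: s | s <- r] ++ r) [:: [::]] ords.

Arguments canon : simpl never.
Arguments subs : simpl never.

Lemma canon_subs s : canon s \in subs.
Proof.
rewrite /canon /subs; elim: ords => [|i l IH] //=.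
by rewrite mem_cat; case: ifP => _; rewrite ?IH ?orbT // map_f.
Qed.

Lemma subs_check : all (fun s => [&& canon s == s, uniq s & inversions s == 0%N]) subs.
Proof. by vm_compute. Qed.

Lemma subsP s : s \in subs -> [/\ canon s = s, uniq s & inversions s = 0%N].
Proof. by move/(allP subs_check)/and3P => [/eqP ? ? /eqP ?]. Qed.

Lemma mem_canon s : canon s =i s.
Proof.
by move=> i; rewrite mem_filter mem_ords andbT; elim: s => //= j s ->; rewrite inE sameE.
Qed.

Lemma canonE s : canon s = [seq i <- ords | i \in s].
Proof.
by apply: eq_in_filter => i _; rewrite -mem_canon mem_filter mem_ords andbT.
Qed.

Lemma enum_canon s : enum [set:: s] = canon s.
Proof.
rewrite canonE -enum_ords enumT {1}/enum_mem; apply: eq_filter => i.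
by rewrite -[LHS]/(i \in [set:: s]) inE.
Qed.

Lemma set_canon s : [set:: canon s] = [set:: s].
Proof. by apply/setP => i; rewrite !inE mem_canon. Qed.

Lemma eq_set_canon s t : ([set:: s] == [set:: t]) = (canon s == canon t).
Proof.
apply/eqP/eqP => [E|E]; first by rewrite -!enum_canon E.
by rewrite -[LHS]set_canon E set_canon.
Qed.

Lemma set_enum (S : {set 'I_6}) : [set:: enum S] = S.
Proof. by apply/setP => i; rewrite inE mem_enum. Qed.

Lemma enum_subs (S : {set 'I_6}) : enum S \in subs.
Proof. by rewrite -[S]set_enum enum_canon canon_subs. Qed.

Definition distinct (s : seq 'I_6) : bool := eqn (size s) (size (canon s)).

Lemma distinctE s : distinct s = uniq s.
Proof.
rewrite -[LHS]/(size s == size (canon s)); apply/esym/uniq_size_uniq.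
  by rewrite -enum_canon enum_uniq.
exact: mem_canon.
Qed.

(** * Rational numbers in the base field *)

Section Cohomology.

Variable K : fieldType.
Hypothesis char0 : [pchar K] =i pred0.
Implicit Type c : cochain K.

Definition zK (z : Z) : K := (int_of_Z z)%:~R.
Definition qK (q : Q) : K := zK (Qnum q) / zK (Zpos (Qden q)).

Lemma zKD z w : zK (Z.add z w) = zK z + zK w.
Proof. by rewrite /zK -rmorphD /= -rmorphD. Qed.

Lemma zKM z w : zK (Z.mul z w) = zK z * zK w.
Proof. by rewrite /zK -rmorphM /= -rmorphM. Qed.

Lemma zK_pos d : zK (Zpos d) != 0.
Proof.
have: (0 < Pos.to_nat d)%N by apply/ssrnat.ltP/Pos2Nat.is_pos.
rewrite -[zK _]/((Pos.to_nat d)%:R); case: (Pos.to_nat d) => // n _.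
by have /pcharf0P -> := char0.
Qed.

Lemma qK_eq p q : Qeq p q -> qK p = qK q.
Proof.
rewrite /Qeq /qK => E; apply/eqP; rewrite eqr_div ?zK_pos // -!zKM E.
by [].
Qed.

Lemma qK_red q : qK (Qred q) = qK q.
Proof. exact/qK_eq/Qred_correct. Qed.

Lemma qKD p q : qK (Qplus p q) = qK p + qK q.
Proof. by rewrite /qK /= addf_div ?zK_pos // zKD !(zKM, Pos2Z.inj_mul). Qed.

Lemma qKM p q : qK (Qmult p q) = qK p * qK q.
Proof. by rewrite /qK /= !(zKM, Pos2Z.inj_mul) mulf_div. Qed.

Lemma qKN q : qK (Qopp q) = - qK q.
Proof. by rewrite /qK /= /zK -mulNr -mulrNz -raddfN. Qed.

Lemma qK0 : qK (0#1) = 0. Proof. by rewrite /qK /zK mul0r. Qed.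
Lemma qK1 : qK (1#1) = 1. Proof. by rewrite /qK /zK divr1. Qed.

Lemma qK_num0 q : Z.eqb (Qnum q) 0 -> qK q = 0.
Proof. by move/Z.eqb_eq; rewrite /qK => ->; rewrite mul0r. Qed.

Definition signq (n : nat) : Q := if odd n then (-1#1) else (1#1).

Lemma qK_sign n : qK (signq n) = (-1) ^+ n.
Proof.
by rewrite /signq -signr_odd; case: odd; rewrite ?expr1 ?expr0 ?qK1 // (qKN (1#1)) qK1.
Qed.

Definition sgnq (s : seq 'I_6) : Q := if distinct s then signq (inversions s) else (0#1).

Lemma qK_sgn s : qK (sgnq s) = sgn s.
Proof. by rewrite /sgnq /sgn distinctE; case: ifP; rewrite ?qK_sign ?qK0. Qed.

Lemma sgn_subs s : s \in subs -> sgn s = 1 :> K.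
Proof. by case/subsP => _ us i0; rewrite /sgn us i0. Qed.

Definition sumq (T : Type) (F : T -> Q) (l : seq T) : Q :=
  foldr (fun t r => Qplus (F t) r) (0#1) l.

Lemma qK_sum (T : Type) (F : T -> Q) l : qK (sumq F l) = \sum_(t <- l) qK (F t).
Proof. by elim: l => [|t l IH] /=; rewrite ?big_nil ?qK0 // big_cons qKD IH. Qed.

(** * Cochains as combinations of monomials *)

Notation key := ('I_6 * seq 'I_6)%type.
Implicit Type P : pred key.

Definition monos : seq key := [seq (a, s) | a <- ords, s <- subs].

Arguments monos : simpl never.

Lemma mem_monos (k : key) : (k \in monos) = (k.2 \in subs).
Proof.
case: k => a s; rewrite /monos; apply/allpairsP/idP => [[[b t] [_ ? [-> ->]]] //|ss].
by exists (a, s); split; rewrite ?mem_ords.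
Qed.

Lemma uniq_monos : uniq monos.
Proof. by vm_compute. Qed.

Definition basis (k : key) : cochain K := mono k.1 k.2.

Definition coord (k : key) c : K := c [set:: k.2] 0 k.1.

Fact coord_is_linear k : linear_for *%R (coord k).
Proof. by move=> a u v; rewrite /coord !ffunE !mxE. Qed.
HB.instance Definition _ k :=
  GRing.isLinear.Build K (cochain K) K *%R (coord k) (coord_is_linear k).

Lemma mono_canon a s : mono a s = sgn s *: mono a (canon s) :> cochain K.
Proof.
apply/ffunP => S; rewrite !ffunE set_canon (sgn_subs (canon_subs s)) scale1r.
by case: ifP => _; rewrite ?scaler0.
Qed.

Lemma mono_val a s u : u \in subs -> s \in subs ->
  mono a s [set:: u] = (u == s)%:R *: evec a :> 'rV[K]_6.
Proof.
move=> su ss; rewrite !ffunE eq_set_canon sgn_subs //.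
have [-> _ _] := subsP su; have [-> _ _] := subsP ss.
by case: eqP; rewrite ?scale1r ?scale0r.
Qed.

Lemma evecE (a b : 'I_6) : (evec a : 'rV[K]_6) 0 b = (b == a)%:R.
Proof. by rewrite mxE eqxx. Qed.

Lemma coord_basis k l : k \in monos -> l \in monos -> coord k (basis l) = (k == l)%:R.
Proof.
case: k l => [a s] [b t]; rewrite !mem_monos /coord /basis /= => ss st.
by rewrite mono_val // mxE evecE -natrM mulnb andbC xpair_eqE.
Qed.

Lemma coord_inj c c' : (forall k, k \in monos -> coord k c = coord k c') -> c = c'.
Proof.
move=> E; apply/ffunP => S; apply/rowP => a.
have := E (a, enum S); rewrite /coord /= set_enum; apply.
by rewrite mem_monos enum_subs.
Qed.

(** In other words, c is a combination of monomials that satisfy P. *)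
Definition supported P c :=
  forall k, k \in monos -> ~~ P k -> coord k c = 0.

Lemma supported_expand P c : supported P c ->
  c = \sum_(k <- monos | P k) coord k c *: basis k.
Proof.
move=> sc; apply: coord_inj => l lm; rewrite linear_sum /=.
under eq_bigr do rewrite linearZ /=.
have [Pl|nPl] := boolP (P l).
  rewrite -big_filter (bigD1_seq l) ?mem_filter ?Pl ?filter_uniq ?uniq_monos //.
  rewrite coord_basis // eqxx mulr1 big_seq_cond big1 => [|k]; first exact: esym (addr0 _).
  rewrite mem_filter => /andP[/andP[_ km] nkl].
  by rewrite coord_basis // eq_sym (negPf nkl) mulr0.
rewrite sc // big_seq_cond big1 // => k /andP[km Pk]; rewrite coord_basis //.
by case: eqP => [kl|]; rewrite ?mulr0 //; rewrite kl Pk in nPl.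
Qed.

Lemma expand c : c = \sum_(k <- monos) coord k c *: basis k.
Proof. exact: (@supported_expand predT). Qed.

Lemma supported0 P : supported P 0.
Proof. by move=> k _ _; rewrite linear0. Qed.

Lemma supportedD P a c c' : supported P c -> supported P c' -> supported P (a *: c + c').
Proof.
by move=> sc sc' k km nP; rewrite linearD linearZ /= sc // sc' // mulr0 addr0.
Qed.

Lemma supported_basis P k : k \in monos -> P k -> supported P (basis k).
Proof.
move=> km Pk l lm nP; rewrite coord_basis //; case: eqP => // E.
by rewrite E Pk in nP.
Qed.

(** Instances of the linearity lemmas at the type of cochains: stated once here,
    they spare the comparison of module structures at each use. *)
Section LinearMaps.

Variable F : {linear cochain K -> cochain K}.

Lemma lmap0 : F 0 = 0 :> cochain K. Proof. exact: linear0. Qed.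

Lemma lmapD (u v : cochain K) : F (u + v) = F u + F v :> cochain K.
Proof. exact: linearD. Qed.

Lemma lmapN (u : cochain K) : F (- u) = - F u :> cochain K.
Proof. exact: linearN. Qed.

Lemma lmapB (u v : cochain K) : F (u - v) = F u - F v :> cochain K.
Proof. exact: linearB. Qed.

Lemma lmapZ a (u : cochain K) : F (a *: u) = a *: F u :> cochain K.
Proof. exact: linearZ. Qed.

Lemma lmap_sum (I : Type) (r : seq I) (P : pred I) (G : I -> cochain K) :
  F (\sum_(i <- r | P i) G i) = \sum_(i <- r | P i) F (G i) :> cochain K.
Proof. exact: linear_sum. Qed.

End LinearMaps.

(** A linear identity on the span of a set of monomials holds as soon as it
    holds on these monomials: this is what reduces it to a finite check. *)
Lemma linear_supported P (F : {linear cochain K -> cochain K}) c :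
  (forall k, k \in monos -> P k -> F (basis k) = 0) -> supported P c -> F c = 0.
Proof.
move=> F0 sc; rewrite (supported_expand sc) lmap_sum big_seq_cond big1 // => k /andP[km Pk].
by rewrite lmapZ F0 // scaler0.
Qed.

Lemma linear_supports P P' (F : {linear cochain K -> cochain K}) c :
  (forall k, k \in monos -> P k -> supported P' (F (basis k))) ->
  supported P c -> supported P' (F c).
Proof.
move=> sF sc; rewrite (supported_expand sc) lmap_sum big_seq_cond.
apply: (big_ind (supported P')) => [|u v su sv|k /andP[km Pk]]; first exact: supported0.
  by rewrite -[u]scale1r; apply: supportedD.
rewrite lmapZ -[X in supported _ X]addr0.
by apply: supportedD; [apply: sF | apply: supported0].
Qed.

(** * Linearity of the operations *)

Fact lie_is_linear u : linear (@lie K u).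
Proof.
move=> a v w; apply/rowP => i; rewrite /lie !mxE; ring.
Qed.
HB.instance Definition _ u :=
  GRing.isLinear.Build K 'rV[K]_6 'rV[K]_6 *:%R (lie u) (lie_is_linear u).

Fact diff_is_linear : linear (@diff K).
Proof.
move=> a u v; apply/ffunP => S; rewrite !ffunE scalerDr !scaler_sumr addrACA.
congr (_ + _); rewrite -big_split /=; apply: eq_bigr => y _.
  rewrite !ffunE linearP scalerDr; congr (_ + _).
  by rewrite !scalerA mulrC.
rewrite scaler_sumr -big_split /=; apply: eq_bigr => x _.
rewrite scalerA [a * _]mulrC -scalerA -scalerDr; congr (_ *: _).
rewrite scaler_sumr -big_split /=; apply: eq_bigr => m _.
rewrite scalerA [a * _]mulrC -scalerA -scalerDr; congr (_ *: _).
by rewrite /ceval !ffunE scalerDr !scalerA [a * _]mulrC.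
Qed.
HB.instance Definition _ :=
  GRing.isLinear.Build K (cochain K) (cochain K) *:%R (@diff K) diff_is_linear.

Fact hcomp_is_linear k : linear (@hcomp K k).
Proof.
move=> a u v; apply/ffunP => S; rewrite !ffunE.
by case: ifP => _; rewrite ?scaler0 ?addr0.
Qed.
HB.instance Definition _ k :=
  GRing.isLinear.Build K (cochain K) (cochain K) *:%R (hcomp k) (hcomp_is_linear k).

Fact dot_is_linear c : linear (dot c).
Proof.
move=> a u v; rewrite /dot scaler_sumr -big_split /=; apply: eq_bigr => S _.
rewrite scaler_sumr -big_split /=; apply: eq_bigr => i _.
rewrite scaler_sumr -big_split /=; apply: eq_bigr => T _.
rewrite scaler_sumr -big_split /=; apply: eq_bigr => j _.
by rewrite scalerA -scalerDl !ffunE !mxE mulrDr mulrCA.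
Qed.
HB.instance Definition _ c :=
  GRing.isLinear.Build K (cochain K) (cochain K) *:%R (dot c) (dot_is_linear c).

(** The product as a function of its left factor, to be used as a linear map. *)
Definition dotr c' c := dot c c'.
Fact dotr_is_linear c : linear (dotr c).
Proof.
move=> a u v; rewrite /dotr /dot scaler_sumr -big_split /=; apply: eq_bigr => S _.
rewrite scaler_sumr -big_split /=; apply: eq_bigr => i _.
rewrite scaler_sumr -big_split /=; apply: eq_bigr => T _.
rewrite scaler_sumr -big_split /=; apply: eq_bigr => j _.
by rewrite scalerA -scalerDl !ffunE !mxE mulrDl mulrA.
Qed.
HB.instance Definition _ c :=
  GRing.isLinear.Build K (cochain K) (cochain K) *:%R (dotr c) (dotr_is_linear c).

Lemma dotDl (u v c : cochain K) : dot (u + v) c = dot u c + dot v c.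
Proof. exact: (lmapD (dotr c)). Qed.

Lemma dotDr (c u v : cochain K) : dot c (u + v) = dot c u + dot c v.
Proof. exact: (lmapD (dot c)). Qed.

Lemma dot0c c : dot 0 c = 0.
Proof. exact: (lmap0 (dotr c)). Qed.

(** * Rational cochains as explicit lists *)

Definition same_key (k l : key) : bool :=
  if same k.1 l.1 then same_seq k.2 l.2 else false.

Lemma same_keyE k l : same_key k l = (k == l).
Proof. by case: k l => [a s] [b t]; rewrite /same_key sameE same_seqE xpair_eqE; case: eqP. Qed.

Notation formal := (seq (Q * key)).

(** Merging terms as they come keeps a list free of zero coefficients and
    of repeated monomials, so that zero is represented by the empty list. *)
Fixpoint insert (q : Q) (k : key) (u : formal) : formal :=
  if u is (q', k') :: u' then
    if same_key k k' then
      let r := Qred (Qplus q q') in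
      if Z.eqb (Qnum r) 0 then u' else (r, k) :: u'
    else (q', k') :: insert q k u'
  else if Z.eqb (Qnum q) 0 then [::] else [:: (q, k)].

Definition addf (u v : formal) : formal :=
  foldr (fun t r => insert t.1 t.2 r) v u.

Definition scalef (q : Q) (u : formal) : formal :=
  [seq (Qmult q t.1, t.2) | t <- u].

Definition subf (u v : formal) : formal := addf (scalef (-1#1) v) u.

Definition linf (F : key -> formal) (u : formal) : formal :=
  foldr (fun t r => addf (scalef t.1 (F t.2)) r) [::] u.

Definition coeff (k : key) (u : formal) : Q :=
  sumq (fun t => if same_key t.2 k then t.1 else (0#1)) u.

Definition term (q : Q) (a : 'I_6) (s : seq 'I_6) : formal :=
  if distinct s then [:: (Qmult q (sgnq s), (a, canon s))] else [::].

(** Only monomials with increasing index sequences, for which distinct keys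
    are linearly independent. *)
Definition wf (u : formal) : Prop := forall t, t \in map snd u -> t \in monos.

Lemma wf_cons t u : wf (t :: u) <-> t.2 \in monos /\ wf u.
Proof.
split=> [w|[tm w] k]; last by rewrite inE => /orP[/eqP->|/w].
by split=> [|k km]; apply: w; rewrite inE ?eqxx ?km ?orbT.
Qed.

Lemma wf_cat u v : wf u -> wf v -> wf (u ++ v).
Proof. by move=> wu wv k; rewrite map_cat mem_cat => /orP[/wu|/wv]. Qed.

Lemma wf_insert q k u : k \in monos -> wf u -> wf (insert q k u).
Proof.
move=> km; elim: u => [|[q' k'] u IH] /= wu; first by case: ifP => // _; apply/wf_cons.
have [k'm wu'] := (wf_cons _ _).1 wu.
case: ifP => _; last by apply/wf_cons; split=> //; apply: IH.
by case: ifP => _ //; apply/wf_cons.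
Qed.

Lemma wf_add u v : wf u -> wf v -> wf (addf u v).
Proof.
move=> wu wv; elim: u wu => //= t u IH /wf_cons[tm wu].
by apply: wf_insert => //; apply: IH.
Qed.

Lemma wf_scale q u : wf u -> wf (scalef q u).
Proof. by move=> wu k; rewrite -map_comp => /wu. Qed.

Lemma wf_sub u v : wf u -> wf v -> wf (subf u v).
Proof. by move=> wu wv; apply: wf_add => //; apply: wf_scale. Qed.

Lemma wf_lin F u : (forall k, k \in monos -> wf (F k)) -> wf u -> wf (linf F u).
Proof.
move=> wF; elim: u => //= t u IH /wf_cons[tm wu].
by apply: wf_add; [apply/wf_scale/wF | apply: IH].
Qed.

Lemma wf_term q a s : wf (term q a s).
Proof. by rewrite /term; case: ifP => // _; apply/wf_cons; rewrite mem_monos canon_subs. Qed.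

Lemma wf_flatten (T : Type) (F : T -> formal) l :
  (forall t, wf (F t)) -> wf (flatten [seq F t | t <- l]).
Proof. by move=> wF; elim: l => //= t l IH; apply: wf_cat. Qed.

Definition interp (u : formal) : cochain K := \sum_(t <- u) qK t.1 *: basis t.2.

Lemma interp_nil : interp [::] = 0. Proof. exact: big_nil. Qed.

Lemma interp_cons t u : interp (t :: u) = qK t.1 *: basis t.2 + interp u.
Proof. exact: big_cons. Qed.

Lemma interp_cat u v : interp (u ++ v) = interp u + interp v.
Proof. exact: big_cat. Qed.

Lemma interp_insert q k u : interp (insert q k u) = qK q *: basis k + interp u.
Proof.
elim: u => [|[q' k'] u IH] /=.
  case: ifP => [/qK_num0 ->|_]; first by rewrite scale0r add0r.
  by rewrite interp_cons.
rewrite same_keyE; case: eqP => [<-|_]; last by rewrite !interp_cons IH addrCA.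
rewrite interp_cons /= addrA -scalerDl -qKD -(qK_red (Qplus q q')).
by case: ifP => [/qK_num0 ->|_]; rewrite ?interp_cons // scale0r add0r.
Qed.

Lemma interp_add u v : interp (addf u v) = interp u + interp v.
Proof.
elim: u => [|t u IH] /=; first by rewrite interp_nil add0r.
by rewrite interp_insert IH interp_cons addrA.
Qed.

Lemma interp_scale q u : interp (scalef q u) = qK q *: interp u.
Proof.
elim: u => [|t u IH] /=; first by rewrite interp_nil scaler0.
by rewrite !interp_cons IH /= qKM scalerDr scalerA.
Qed.

Lemma interp_sub u v : interp (subf u v) = interp u - interp v.
Proof. by rewrite interp_add interp_scale (qKN (1#1)) qK1 scaleN1r addrC. Qed.

Lemma interp_lin (F : {linear cochain K -> cochain K}) (f : key -> formal) u :
  (forall k, k \in monos -> F (basis k) = interp (f k)) ->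
  wf u -> F (interp u) = interp (linf f u).
Proof.
move=> Ff; elim: u => [|t u IH]; first by rewrite interp_nil lmap0.
move/wf_cons => [tm wu]; rewrite interp_cons lmapD lmapZ IH // Ff //.
by rewrite interp_add interp_scale.
Qed.

Lemma interp_term q a s : interp (term q a s) = qK q *: mono a s.
Proof.
rewrite mono_canon scalerA -qK_sgn -qKM /term; case: ifP => us.
  by rewrite interp_cons interp_nil addr0.
by rewrite interp_nil /sgnq us qKM qK0 mulr0 scale0r.
Qed.

Lemma interp_flatten (T : Type) (F : T -> formal) l :
  interp (flatten [seq F t | t <- l]) = \sum_(t <- l) interp (F t).
Proof.
by elim: l => [|t l IH] /=; rewrite ?big_nil ?interp_nil // big_cons interp_cat IH.
Qed.

Lemma coord_interp k u : k \in monos -> wf u -> coord k (interp u) = qK (coeff k u).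
Proof.
move=> km; elim: u => [|t u IH]; first by rewrite interp_nil linear0 qK0.
move/wf_cons => [tm wu]; rewrite interp_cons linearD linearZ /= IH // qKD coord_basis //.
by rewrite same_keyE eq_sym; case: eqP => _; rewrite ?mulr1 // mulr0 qK0.
Qed.

(** * The product on monomials *)

Definition fdot (k l : key) : formal :=
  flatten [seq if same (nth i01 k.2 j) l.1 then
                 term (signq (size k.2 - j.+1)) k.1
                      (take j k.2 ++ drop j.+1 k.2 ++ l.2)
               else [::]
          | j <- iota 0 (size k.2)].

Lemma wf_fdot k l : wf (fdot k l).
Proof. by apply: wf_flatten => j; case: ifP => // _; apply: wf_term. Qed.

Lemma interp_fdot k l : interp (fdot k l) = dot_mono k.1 k.2 l.1 l.2.
Proof.
rewrite interp_flatten /dot_mono -(big_mkord xpredT (fun j =>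
  ((-1) ^+ (size k.2 - j.+1) * evec l.1 0 (nth i01 k.2 j)) *:
    mono k.1 (take j k.2 ++ drop j.+1 k.2 ++ l.2))) /index_iota subn0.
apply: eq_bigr => j _; rewrite evecE sameE.
case: eqP => _; last by rewrite interp_nil mulr0 scale0r.
by rewrite interp_term qK_sign mulr1.
Qed.

Lemma sum_single (I : finType) (V : zmodType) (F : I -> V) i :
  (forall j, j != i -> F j = 0) -> \sum_j F j = F i.
Proof. by move=> F0; rewrite (bigD1 i) //= big1 ?addr0 // => j /F0. Qed.

Lemma coord_enum (c : cochain K) (S : {set 'I_6}) a : c S 0 a = coord (a, enum S) c :> K.
Proof. by rewrite /coord /= set_enum. Qed.

Lemma dot_basis k l : k \in monos -> l \in monos ->
  dot (basis k) (basis l) = interp (fdot k l).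
Proof.
move=> km lm; rewrite interp_fdot /dot.
have z k' : k' \in monos -> forall (S : {set 'I_6}) i, (i, enum S) != k' -> basis k' S 0 i = 0.
  move=> k'm S i nk; rewrite coord_enum coord_basis ?(negPf nk) //.
  by rewrite mem_monos enum_subs.
have E k' : k' \in monos -> enum [set:: k'.2] = k'.2.
  by rewrite mem_monos enum_canon => /subsP[].
have ne k' (S : {set 'I_6}) i : S != [set:: k'.2] -> (i, enum S) != k'.
  by apply: contraNneq => <-; rewrite set_enum.
rewrite (sum_single (i := [set:: k.2])) => [|S nS]; last first.
  by rewrite big1 // => i _; do 2 rewrite big1 // => ? _; rewrite z ?ne // mul0r scale0r.
rewrite (sum_single (i := k.1)) => [|i ni]; last first.
  do 2 rewrite big1 // => ? _; rewrite z // ?mul0r ?scale0r //.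
  by apply: contraNneq ni => <-.
rewrite (sum_single (i := [set:: l.2])) => [|S nS]; last first.
  by rewrite big1 // => i _; rewrite [basis l _ _ _]z ?ne // mulr0 scale0r.
rewrite (sum_single (i := l.1)) => [|i ni]; last first.
  rewrite [basis l _ _ _]z ?mulr0 ?scale0r //.
  by apply: contraNneq ni => <-.
rewrite !coord_enum !E // -!surjective_pairing !coord_basis // !eqxx mulr1 scale1r.
by [].
Qed.

Definition dotf (u v : formal) : formal := linf (fun k => linf (fdot k) v) u.

Lemma wf_dot u v : wf u -> wf v -> wf (dotf u v).
Proof.
by move=> wu wv; do 2 (apply: wf_lin => // ? _); apply: wf_fdot.
Qed.

Lemma interp_dot u v : wf u -> wf v -> dot (interp u) (interp v) = interp (dotf u v).
Proof.
move=> wu wv; rewrite -[LHS]/(dotr (interp v) (interp u)).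
apply: interp_lin => // k km; rewrite /dotr.
by apply: interp_lin => // l lm; apply: dot_basis.
Qed.

(** * The differential on monomials *)

Definition brackets : seq (Q * ('I_6 * 'I_6 * 'I_6)) :=
  [:: (1#1, (i01, i10, i11)); (2#1, (i01, i11, i12)); (3#1, (i01, i12, i13));
      (1#1, (i10, i13, i23)); (-3#1, (i11, i12, i23))].

(** Maurer-Cartan formula: d(e_a (x) w) is the sum of the
    [e_x, e_a] (x) f^x /\ w and of e_a (x) dw, where d is the antiderivation
    of the exterior algebra with d f^m (e_x, e_y) = - f^m [e_x, e_y]. *)
Definition fdiff (k : key) : formal :=
  let: (a, s) := k in
  flatten [seq let: (q, (x, y, m)) := r in
    (if same y a then term q m (x :: s) else [::])
    ++ (if same x a then term (Qopp q) m (y :: s) else [::])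
    ++ flatten [seq if same (nth i01 s j) m then
                      term (Qmult (signq j.+1) q) a
                           (take j s ++ [:: x, y & drop j.+1 s])
                    else [::]
               | j <- iota 0 (size s)]
  | r <- brackets].

Lemma wf_fdiff k : wf (fdiff k).
Proof.
case: k => a s; apply: wf_flatten => -[q [[x y] m]].
have wt b u : wf u -> wf (if b then u else [::]) by case: b.
do 2 (apply: wf_cat; first by apply/wt/wf_term).
by apply: wf_flatten => j; apply/wt/wf_term.
Qed.

Definition lie_terms (x y : 'I_6) : seq (Q * 'I_6) :=
  flatten [seq let: (q, (i, j, m)) := r in
     (if same x i then if same y j then [:: (q, m)] else [::] else [::])
     ++ (if same x j then if same y i then [:: (Qopp q, m)] else [::] else [::])
   | r <- brackets].

(** The coordinate on the monomial l of the differential of the monomial k,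
    read off the alternating sums that define the differential. *)
Definition diff_coeff (k l : key) : Q :=
  let: (a, s) := k in let: (b, u) := l in
  Qplus
   (sumq (fun x => sumq (fun t => if same b t.2 then
        if same_seq (canon [seq i <- u | ~~ same i x]) s
        then Qmult (signq (find (same^~ x) u)) t.1
        else (0#1)
      else (0#1)) (lie_terms x a)) u)
   (if same b a then
     sumq (fun y : 'I_6 => sumq (fun x : 'I_6 => if (x < y)%N then
       sumq (fun t => let v := t.2 :: [seq i <- [seq i <- u | ~~ same i x] | ~~ same i y] in
          if same_seq (canon v) s then
             Qmult (Qmult (signq (find (same^~ x) u + find (same^~ y) u)) t.1) (sgnq v)
          else (0#1)) (lie_terms x y)
       else (0#1)) u) u
    else (0#1)).

Lemma qK_int z : qK (z#1) = (int_of_Z z)%:~R.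
Proof. by rewrite /qK /zK /= divr1. Qed.

Lemma lieE (u v : 'rV[K]_6) : lie u v =
  \sum_(r <- brackets) (qK r.1 * (u 0 r.2.1.1 * v 0 r.2.1.2 - u 0 r.2.1.2 * v 0 r.2.1.1))
      *: evec r.2.2.
Proof.
rewrite /lie /brackets !big_cons big_nil addr0 /= !qK_int !addrA.
by rewrite !mul1r !scalerA; do !congr (_ + _ *: _); rewrite mulrC.
Qed.

Lemma lie_evec x y : lie (evec x) (evec y) = \sum_(t <- lie_terms x y) qK t.1 *: evec t.2.
Proof.
rewrite lieE /lie_terms big_flatten big_map; apply: eq_bigr => -[q [[i j] m]] _.
rewrite !evecE /= big_cat /= (eq_sym i) (eq_sym j) (eq_sym i) (eq_sym j).
rewrite -!natrM !mulnb mulrBr scalerBl.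
rewrite !sameE; congr (_ + _).
  by case: (x == i); case: (y == j); rewrite ?big_nil ?mulr0 ?scale0r // big_seq1 mulr1.
case: (x == j); case: (y == i); rewrite /= ?big_nil ?mulr0 ?scale0r ?oppr0 //.
by rewrite big_seq1 qKN mulr1 scaleNr.
Qed.

Lemma mono_set a s v : s \in subs ->
  mono a s [set:: v] = (canon v == s)%:R *: evec a :> 'rV[K]_6.
Proof. by move=> ss; rewrite -set_canon mono_val ?canon_subs. Qed.

Lemma setD1_filter (u : seq 'I_6) x : [set:: u] :\ x = [set:: [seq i <- u | i != x]].
Proof. by apply/setP => i; rewrite !inE mem_filter. Qed.

Lemma big_set (V : zmodType) (u : seq 'I_6) (F : 'I_6 -> V) : u \in subs ->
  \sum_(i in [set:: u]) F i = \sum_(i <- u) F i.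
Proof.
by move=> su; rewrite -big_enum enum_canon; have [-> _ _] := subsP su.
Qed.

Lemma canon_filter (u : seq 'I_6) p : u \in subs -> canon [seq i <- u | p i] = [seq i <- u | p i].
Proof.
case/subsP => cu _ _; rewrite -[in RHS]cu !canonE -filter_predI.
by apply: eq_filter => i; rewrite mem_filter.
Qed.

Lemma sum_lie x y (G : 'I_6 -> 'rV[K]_6) :
  \sum_(m < 6) lie (evec x) (evec y) 0 m *: G m
  = \sum_(t <- lie_terms x y) qK t.1 *: G t.2.
Proof.
rewrite lie_evec; under eq_bigr do rewrite summxE scaler_suml.
rewrite exchange_big; apply: eq_bigr => t _.
rewrite (sum_single (i := t.2)) => [|m nm]; rewrite mxE evecE.
  by rewrite eqxx mulr1.
by rewrite (negPf nm) mulr0 scale0r.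
Qed.

Lemma coord_diff k l : k \in monos -> l \in monos ->
  coord l (diff (basis k)) = qK (diff_coeff k l).
Proof.
case: k l => [a s] [b u]; rewrite !mem_monos /= => ss su.
have [cu _ _] := subsP su.
rewrite /coord ffunE mxE qKD !summxE; congr (_ + _).
  rewrite big_set // qK_sum; apply: eq_bigr => x _.
  rewrite enum_canon cu setD1_filter mono_set // linearZ /=.
  rewrite lie_evec !mxE summxE !mulr_sumr qK_sum; apply: eq_bigr => t _.
  rewrite mxE evecE sameE same_seqE; case: (b == t.2); last by rewrite !mulr0 qK0.
  case: (canon _ == s); last by rewrite mul0r mulr0 qK0.
  by rewrite qKM qK_sign mul1r mulr1.
have wE x y : enum ([set:: u] :\ x :\ y)
    = [seq i <- [seq i <- u | i != x] | i != y].
  rewrite !setD1_filter enum_canon -filter_predI.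
  by rewrite (canon_filter (fun i => (i != y) && (i != x))).
transitivity (\sum_(y <- u) \sum_(x <- u | (x < y)%N)
   \sum_(t <- lie_terms x y) let v := t.2 :: [seq i <- [seq i <- u | i != x] | i != y] in
     (-1) ^+ (index x u + index y u) * (qK t.1 * (sgn v * ((canon v == s)%:R * (b == a)%:R)))).
  rewrite big_set //; apply: eq_bigr => y _; rewrite summxE big_mkcondr big_set // -big_mkcond.
  apply: eq_bigr => x _; rewrite enum_canon cu sum_lie mxE summxE mulr_sumr.
  apply: eq_bigr => t _; rewrite wE /ceval mono_set //.
  by rewrite !mxE eqxx.
rewrite sameE; case: (b == a); last first.
  rewrite qK0 big1 // => y _; rewrite big1 // => x _; rewrite big1 // => t _.
  by rewrite /= !mulr0.
rewrite qK_sum; apply: eq_bigr => y _; rewrite qK_sum big_mkcond.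
apply: eq_bigr => x _; case: ifP => _; last by rewrite qK0.
rewrite qK_sum; apply: eq_bigr => t _ /=; rewrite mulr1 same_seqE.
case: ifP => _; last by rewrite qK0 !mulr0.
by rewrite !qKM qK_sign qK_sgn mulr1 mulrA.
Qed.

(** The exterior-algebra formula agrees with the alternating-sum definition. *)
Lemma fdiff_check :
  all (fun k => let u := fdiff k in
    all (fun l => Qeq_bool (diff_coeff k l) (coeff l u)) monos) monos.
Proof. by vm_cast_no_check (erefl true). Qed.

Lemma diff_basis k : k \in monos -> diff (basis k) = interp (fdiff k).
Proof.
move=> km; apply: coord_inj => l lm.
rewrite coord_diff // coord_interp //; last exact: wf_fdiff.
exact/qK_eq/Qeq_bool_eq/(allP (allP fdiff_check k km) l lm).
Qed.

Definition difff (u : formal) : formal := linf fdiff u.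

Lemma interp_diff u : wf u -> diff (interp u) = interp (difff u).
Proof. by move=> wu; apply: interp_lin => // k; apply: diff_basis. Qed.

(** * The Leibniz rule *)

Definition even_key (k : key) : bool := ~~ odd (size k.2).

Definition mon (k : key) : formal := [:: (1#1, k)].

Lemma wf_mon k : k \in monos -> wf (mon k).
Proof. by move=> km; apply/wf_cons. Qed.

(** Cochains of even degree are odd in the Lie superalgebra and conversely, so
    for c of even and b of odd degree [c, db] = c . db + db . c, while
    [c, b] = c . b - b . c: the vanishing of this expression is the Leibniz
    rule for the bracket. *)
Definition leibniz_defect (c b : key) : formal :=
  let db := fdiff b in let dc := fdiff c in
  subf (addf (dotf (mon c) db) (dotf db (mon c)))
       (addf (difff (subf (fdot b c) (fdot c b)))
             (subf (dotf dc (mon b)) (dotf (mon b) dc))).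

Lemma leibniz_check :
  all (fun k => all (fun l => nilp (leibniz_defect k l))
                    [seq l <- monos | ~~ even_key l])
      [seq k <- monos | even_key k].
Proof. by vm_cast_no_check (erefl true). Qed.

Lemma interp_mon k : interp (mon k) = basis k.
Proof. by rewrite interp_cons interp_nil addr0 qK1 scale1r. Qed.

Definition leibniz_map (c : cochain K) : cochain K -> cochain K :=
  ((dot c \+ dotr c) \o @diff K) \- (@diff K \o (dotr c \- dot c))
  \- (dot (diff c) \- dotr (diff c)).
HB.instance Definition _ c := GRing.Linear.on (leibniz_map c).

Definition leibniz_mapr (b : cochain K) : cochain K -> cochain K :=
  (dotr (diff b) \+ dot (diff b)) \- (@diff K \o (dot b \- dotr b))
  \- ((dotr b \- dot b) \o @diff K).
HB.instance Definition _ b := GRing.Linear.on (leibniz_mapr b).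

(** Both sides are bilinear in c and b, so the check on monomials suffices. *)
Lemma leibniz (c b : cochain K) : supported even_key c -> supported (predC even_key) b ->
  dot c (diff b) + dot (diff b) c
  = diff (dot b c - dot c b) + (dot (diff c) b - dot b (diff c)).
Proof.
move=> sc sb; apply/eqP; rewrite -subr_eq0 opprD addrA; apply/eqP.
rewrite -[LHS]/(leibniz_map c b); apply: linear_supported sb => l lm ol.
rewrite -[LHS]/(leibniz_mapr (basis l) c); apply: linear_supported sc => k km ek.
have wk := wf_mon km; have wl := wf_mon lm; have wdk := @wf_fdiff k; have wdl := @wf_fdiff l.
have ke : k \in [seq k <- monos | even_key k] by rewrite mem_filter ek.
have lo : l \in [seq l <- monos | ~~ even_key l] by rewrite mem_filter [~~ _]ol.
have /nilP/(congr1 interp) := allP (allP leibniz_check k ke) l lo.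
rewrite interp_nil !(interp_sub, interp_add, =^~interp_dot, =^~interp_diff) //; last first.
  by apply: wf_sub; apply: wf_fdot.
rewrite !interp_mon -!dot_basis // -!diff_basis //.
by rewrite opprD addrA.
Qed.

(** * Linear forms *)

Definition pairf (f u : formal) : Q :=
  sumq (fun t => Qmult t.1 (coeff t.2 u)) f.

(** Closed linear forms vanish on coboundaries, hence are defined on cohomology. *)
Definition closedf (f : formal) : bool :=
  all (fun k => Z.eqb (Qnum (pairf f (fdiff k))) 0) monos.

Definition wfb (u : formal) : bool := all (fun t => t.2 \in monos) u.

Lemma wfP u : wfb u -> wf u.
Proof. by elim: u => //= t u IH /andP[tm /IH wu]; apply/wf_cons. Qed.

Definition pair (f : formal) (c : cochain K) : K :=
  \sum_(t <- f) qK t.1 * coord t.2 c.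

Fact pair_is_linear f : linear_for *%R (pair f).
Proof.
move=> a u v; rewrite /pair mulr_sumr -big_split; apply: eq_bigr => t _.
by rewrite linearP mulrDr mulrCA.
Qed.
HB.instance Definition _ f :=
  GRing.isLinear.Build K (cochain K) K *%R (pair f) (pair_is_linear f).

Lemma pair_interp f u : wf f -> wf u -> pair f (interp u) = qK (pairf f u).
Proof.
move=> wwf wu; rewrite /pair; elim: f wwf => [|t f IH]; first by rewrite big_nil qK0.
by case/wf_cons => tm wwf; rewrite big_cons IH // qKD qKM coord_interp.
Qed.

Lemma pair_diff f c : wf f -> closedf f -> pair f (diff c) = 0.
Proof.
move=> wwf /allP cf; rewrite [c]expand lmap_sum linear_sum big_seq big1 // => k km.
rewrite lmapZ linearZ /= diff_basis // pair_interp //; last exact: wf_fdiff.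
by rewrite qK_num0 ?mulr0 ?cf.
Qed.

(** * A homotopy by Gaussian elimination *)

(** A row (v, w) of the elimination satisfies v = dw.  Rows are stored with
    the monomial of their pivot, whose coefficient in v is 1 and which occurs
    in the v of no other row. *)
Notation row := (formal * formal)%type.

Definition eliminate (p : key * row) (r : row) : row :=
  let a := coeff p.1 r.1 in
  (subf r.1 (scalef a p.2.1), subf r.2 (scalef a p.2.2)).

Definition add_row (P : seq (key * row)) (k : key) : seq (key * row) :=
  let r := foldl (fun r t => eliminate t r) (fdiff k, mon k) P in
  if r.1 is (a, l) :: _ then
    let t := (l, (scalef (Qinv a) r.1, scalef (Qinv a) r.2)) in
    t :: [seq (t'.1, eliminate t t'.2) | t' <- P]
  else P.

(** Every coboundary is the sum of the rows multiplied by its coordinates on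
    the pivots.  So the linear map that sends each pivot to the w of its row
    and all other monomials to 0 sends each coboundary to a primitive of it.
    The identities that use this map are checked directly, so the elimination
    itself needs no proof of correctness. *)
Definition primitives : seq (key * formal) := Eval vm_compute in
  [seq (t.1, t.2.2) | t <- foldl add_row [::] monos].

Definition primitive (k : key) : formal :=
  foldr (fun t r => if same_key t.1 k then t.2 else r) [::] primitives.

Lemma primitives_wf : all (fun t => wfb t.2) primitives.
Proof. by vm_cast_no_check (erefl true). Qed.

Lemma wf_primitive k : wf (primitive k).
Proof.
rewrite /primitive; elim: primitives primitives_wf => //= p l IH /andP[/wfP wp /IH wl].
by case: ifP.
Qed.

Definition primf (u : formal) : formal := linf primitive u.

Lemma wf_prim u : wf u -> wf (primf u).
Proof. by move=> wu; apply: wf_lin => // k _; apply: wf_primitive. Qed.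

Definition prim (c : cochain K) : cochain K :=
  \sum_(k <- monos) coord k c *: interp (primitive k).

Fact prim_is_linear : linear prim.
Proof.
move=> a u v; rewrite /prim scaler_sumr -big_split; apply: eq_bigr => k _.
by rewrite linearP scalerDl scalerA.
Qed.
HB.instance Definition _ :=
  GRing.isLinear.Build K (cochain K) (cochain K) *:%R prim prim_is_linear.

Lemma prim_basis k : k \in monos -> prim (basis k) = interp (primitive k).
Proof.
move=> km; rewrite /prim (bigD1_seq k) ?uniq_monos //= coord_basis // eqxx scale1r.
rewrite big_seq_cond big1 => [|l /andP[lm nlk]]; first exact: addr0.
by rewrite coord_basis // (negPf nlk) scale0r.
Qed.

Lemma interp_prim u : wf u -> prim (interp u) = interp (primf u).
Proof. by move=> wu; apply: interp_lin => // k; apply: prim_basis. Qed.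

(** * Bases of the cohomology and dual linear forms *)

Definition reps : seq formal :=
  [::
   [:: (1#1, (i23, [::]))];
   [:: (-1#1, (i01, [:: i10; i11])); (1#1, (i13, [:: i10; i23]))];
   [:: (-68#1, (i01, [:: i01; i11])); (216#1, (i10, [:: i10; i11]));
       (74#1, (i11, [:: i10; i12])); (39#1, (i12, [:: i10; i13]));
       (31#1, (i12, [:: i11; i12])); (-9#1, (i13, [:: i01; i23]));
       (108#1, (i13, [:: i11; i13])); (9#1, (i23, [:: i11; i23]))];
   [:: (-1#1, (i01, [:: i01; i10])); (1#1, (i11, [:: i10; i11]));
       (2#1, (i12, [:: i10; i12])); (3#1, (i13, [:: i10; i13]));
       (3#1, (i23, [:: i10; i23]))];
   [:: (1#1, (i13, [:: i10; i11]))];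
   [:: (1#1, (i10, [:: i01; i13]))];
   [:: (11#1, (i10, [:: i01; i11])); (14#1, (i11, [:: i01; i12]));
       (9#1, (i12, [:: i01; i13])); (8#1, (i23, [:: i12; i13]))];
   [:: (1#1, (i10, [:: i01; i10])); (1#1, (i11, [:: i01; i11]));
       (1#1, (i12, [:: i01; i12])); (1#1, (i13, [:: i01; i13]));
       (2#1, (i23, [:: i01; i23]))];
   [:: (1#1, (i01, [:: i10; i11; i12; i23]))];
   [:: (-4#1, (i01, [:: i01; i10; i12; i23]));
       (35#1, (i01, [:: i10; i11; i12; i13]));
       (-31#1, (i11, [:: i10; i11; i12; i23]));
       (-18#1, (i12, [:: i10; i11; i13; i23]));
       (-27#1, (i13, [:: i10; i12; i13; i23]))];
   [:: (1#1, (i01, [:: i01; i10; i11; i23]));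
       (1#1, (i12, [:: i10; i11; i12; i23]));
       (2#1, (i13, [:: i10; i11; i13; i23]))];
   [:: (1#1, (i10, [:: i01; i12; i13; i23]))];
   [:: (1#1, (i10, [:: i01; i11; i13; i23]));
       (2#1, (i11, [:: i01; i12; i13; i23]))];
   [:: (11#1, (i01, [:: i01; i11; i12; i13]));
       (-4#1, (i10, [:: i01; i10; i12; i23]));
       (-4#1, (i10, [:: i10; i11; i12; i13]));
       (-7#1, (i11, [:: i01; i11; i12; i23]));
       (-9#1, (i12, [:: i01; i11; i13; i23]));
       (-5#1, (i13, [:: i01; i12; i13; i23]));
       (1#1, (i23, [:: i11; i12; i13; i23]))];
   [:: (1#1, (i10, [:: i01; i10; i12; i13]));
       (1#1, (i11, [:: i01; i11; i12; i13]));
       (1#1, (i23, [:: i01; i12; i13; i23]))];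
   [:: (1#1, (i01, [:: i01; i10; i11; i12; i13; i23]))];
   [:: (1#1, (i10, [:: i01; i10; i11; i12; i13; i23]))]].

(** Since the weights of the h_j of a given degree are distinct, each form has
    to be found only in the cochains of one degree and weight; it is determined
    up to forms that vanish on cocycles, and a form of smallest support was
    chosen. *)
Definition phis : seq formal :=
  [::
   [:: (1#1, (i23, [::]))];
   [:: (-1#1, (i01, [:: i10; i11]))];
   [:: (1#216, (i10, [:: i10; i11]))];
   [:: (1#2, (i12, [:: i10; i12]))];
   [:: (1#1, (i13, [:: i10; i11]))];
   [:: (1#1, (i10, [:: i01; i13]))];
   [:: (1#66, (i10, [:: i01; i11])); (1#33, (i11, [:: i01; i12]));
       (1#22, (i12, [:: i01; i13]))];
   [:: (1#2, (i23, [:: i01; i23]))];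
   [:: (1#1, (i01, [:: i10; i11; i12; i23]))];
   [:: (1#93, (i01, [:: i01; i10; i12; i23]));
       (1#93, (i01, [:: i10; i11; i12; i13]));
       (-2#93, (i11, [:: i10; i11; i12; i23]))];
   [:: (1#2, (i13, [:: i10; i11; i13; i23]))];
   [:: (1#1, (i10, [:: i01; i12; i13; i23]))];
   [:: (1#5, (i10, [:: i01; i11; i13; i23]));
       (2#5, (i11, [:: i01; i12; i13; i23]))];
   [:: (5#103, (i01, [:: i01; i11; i12; i13]));
       (-1#103, (i11, [:: i01; i11; i12; i23]));
       (-3#103, (i12, [:: i01; i11; i13; i23]));
       (-3#103, (i13, [:: i01; i12; i13; i23]));
       (-1#103, (i23, [:: i11; i12; i13; i23]))];
   [:: (1#3, (i10, [:: i01; i10; i12; i13]));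
       (1#3, (i11, [:: i01; i11; i12; i13]));
       (1#3, (i23, [:: i01; i12; i13; i23]))];
   [:: (1#1, (i01, [:: i01; i10; i11; i12; i13; i23]))];
   [:: (1#1, (i10, [:: i01; i10; i11; i12; i13; i23]))]].

(** Obtained in the same way in odd degrees, normalised on the classes that
    lead the lists of quadrics below. *)
Definition psis : seq formal :=
  [::
   [:: (1#1, (i13, [:: i10]))];
   [:: (1#2, (i23, [:: i01]))];
   [:: (1#1, (i01, [:: i10; i11; i12])); (3#2, (i12, [:: i10; i11; i23]))];
   [:: (-1#4, (i13, [:: i01; i10; i23])); (1#2, (i13, [:: i10; i11; i13]));
       (1#4, (i23, [:: i10; i11; i23]))];
   [:: (1#1, (i10, [:: i01; i12; i13]))];
   [:: (1#5, (i10, [:: i01; i11; i13])); (2#5, (i11, [:: i01; i12; i13]))];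
   [:: (-1#324, (i13, [:: i10; i11; i23]))];
   [:: (1#10, (i10, [:: i01; i10; i13])); (-1#30, (i10, [:: i01; i11; i12]));
       (-1#5, (i23, [:: i01; i13; i23]))];
   [:: (-1#1, (i01, [:: i01; i11; i12; i13; i23]))];
   [:: (1#432, (i10, [:: i01; i11; i12; i13; i23]))];
   [:: (1#10, (i10, [:: i01; i10; i12; i13; i23]));
       (1#10, (i11, [:: i01; i11; i12; i13; i23]))];
   [:: (-1#6, (i01, [:: i01; i10; i11; i12; i23]));
       (1#6, (i13, [:: i10; i11; i12; i13; i23]))]].

(** The product table of the cohomology: an entry (q, (i, j)) of the m-th list
    says that [h_i, h_j] has coordinate q on the m-th of twelve independent
    classes.  Unlisted brackets vanish. *)
Definition quadrics : seq (seq (Q * (nat * nat))) :=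
  [:: [:: (1#1, (0, 1))];
      [:: (1#1, (0, 7))];
      [:: (1#1, (0, 8))];
      [:: (1#1, (0, 10)); (3#2, (1, 7)); (-540#1, (2, 3))];
      [:: (1#1, (0, 11))];
      [:: (1#1, (0, 12)); (108#1, (2, 5))];
      [:: (1#1, (1, 2))];
      [:: (1#1, (3, 5))];
      [:: (1#1, (1, 11)); (1#1, (5, 8))];
      [:: (1#1, (2, 11))];
      [:: (1#1, (3, 11))];
      [:: (1#1, (7, 8))]]%N.

Definition quadric (m : nat) := nth [::] quadrics m.

Definition rep (j : nat) : formal := nth [::] reps j.
Definition phif (j : nat) : formal := nth [::] phis j.
Definition psif (m : nat) : formal := nth [::] psis m.

Lemma reps_check : all (fun j => [&& wfb (rep j), nilp (difff (rep j)),
  all (fun t => even_key t.2) (rep j), wfb (phif j) & closedf (phif j)]) (iota 0 17).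
Proof. by vm_cast_no_check (erefl true). Qed.

Lemma dual_check : all (fun i => all (fun j =>
    Qeq_bool (pairf (phif i) (rep j)) (if eqn i j then 1#1 else 0#1)) (iota 0 17)) (iota 0 17).
Proof. by vm_cast_no_check (erefl true). Qed.

Lemma psis_check : all (fun m => if wfb (psif m) then closedf (psif m) else false) (iota 0 12).
Proof. by vm_cast_no_check (erefl true). Qed.

Definition sum_rep (F : nat -> Q) : formal :=
  foldr (fun j v => addf (scalef (F j) (rep j)) v) [::] (iota 0 17).

(** If t denotes the map primitive, then c = c - t(dc) for a cocycle c, and
    z = k - t(dk) is a cocycle for each monomial k; what is left of z after
    subtracting its harmonic part has to be a coboundary. *)
Definition hodge_rest (k : key) : formal :=
  let z := subf (mon k) (primf (fdiff k)) in
  subf z (sum_rep (fun j => pairf (phif j) z)).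

Definition hodge_primitive (k : key) : formal := primf (hodge_rest k).

Lemma hodge_check : all (fun k => all (fun t => ~~ even_key t.2) (hodge_primitive k)
    && nilp (subf (hodge_rest k) (difff (hodge_primitive k))))
  [seq k <- monos | even_key k].
Proof. by vm_cast_no_check (erefl true). Qed.

Definition square (i j : nat) : formal :=
  addf (dotf (rep i) (rep j)) (dotf (rep j) (rep i)).

(** The first bracket of each list has coordinate 1 on the m-th class and 0 on
    the others, hence represents this class. *)
Definition lead (m : nat) : formal :=
  let p := head (0#1, (0, 0))%N (quadric m) in square p.2.1 p.2.2.

Definition square_rest (i j : nat) : formal :=
  let s := square i j in
  subf s (foldr (fun m v => addf (scalef (pairf (psif m) s) (lead m)) v) [::] (iota 0 12)).

Lemma square_check : all (fun i => all (fun j => let r := square_rest i j in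
    nilp (subf r (difff (primf r)))) (iota 0 17)) (iota 0 17).
Proof. by vm_cast_no_check (erefl true). Qed.

Definition quadric_coeff (m i j : nat) : Q :=
  sumq (fun t =>
    Qplus (if eqn i t.2.1 then if eqn j t.2.2 then t.1 else 0#1 else 0#1)
          (if eqn i t.2.2 then if eqn j t.2.1 then t.1 else 0#1 else 0#1)) (quadric m).

Lemma quadric_check : all (fun m => all (fun i => all (fun j =>
    Qeq_bool (pairf (psif m) (square i j)) (quadric_coeff m i j)) (iota 0 17)) (iota 0 17))
  (iota 0 12).
Proof. by vm_cast_no_check (erefl true). Qed.

Lemma quadric_small :
  all (fun m => all (fun t => (t.2.1 < 17)%N && (t.2.2 < 17)%N) (quadric m)) (iota 0 12).
Proof. by vm_cast_no_check (erefl true). Qed.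

Lemma iota_check n (P : nat -> bool) : all P (iota 0 n) -> forall j, (j < n)%N -> P j.
Proof. by move/allP=> aP j jn; apply: aP; rewrite mem_iota. Qed.

Lemma repP j : (j < 17)%N ->
  [/\ wf (rep j), difff (rep j) = [::], all (fun t => even_key t.2) (rep j),
      wf (phif j) & closedf (phif j)].
Proof.
by move/(iota_check reps_check)/and5P => [/wfP ? /nilP ? ? /wfP ? ?].
Qed.

Lemma psiP m : (m < 12)%N -> wf (psif m) /\ closedf (psif m).
Proof.
move/(iota_check psis_check); case: ifP => // /wfP.
by [].
Qed.

Lemma wf_square i j : (i < 17)%N -> (j < 17)%N -> wf (square i j).
Proof. by move=> /repP[? _ _ _ _] /repP[? _ _ _ _]; apply: wf_add; apply: wf_dot. Qed.

Implicit Types b x : cochain K.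

Definition cls (j : nat) : cochain K := interp (rep j).
Definition phi (j : nat) c : K := pair (phif j) c.
Definition psi (m : nat) c : K := pair (psif m) c.

HB.instance Definition _ j :=
  GRing.isLinear.Build K (cochain K) K *%R (phi j) (pair_is_linear (phif j)).
HB.instance Definition _ m :=
  GRing.isLinear.Build K (cochain K) K *%R (psi m) (pair_is_linear (psif m)).

Lemma supported_interp (P : pred key) u : wf u -> all (fun t => P t.2) u ->
  supported P (interp u).
Proof.
elim: u => [|t u IH] wu /=; first by move=> _; rewrite interp_nil; apply: supported0.
move=> /andP[Pt Pu]; have [tm {}wu] := (wf_cons _ _).1 wu.
by rewrite interp_cons; apply: supportedD; [apply: supported_basis | apply: IH].
Qed.

Lemma cls_cocycle j : (j < 17)%N -> diff (cls j) = 0.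
Proof. by case/repP => wr dr _ _ _; rewrite interp_diff // dr interp_nil. Qed.

Lemma cls_even j : (j < 17)%N -> supported even_key (cls j).
Proof. by case/repP => wr _ er _ _; apply: supported_interp. Qed.

Lemma phi_diff j c : (j < 17)%N -> phi j (diff c) = 0.
Proof. by case/repP => _ _ _ wp cp; apply: pair_diff. Qed.

Lemma psi_diff m c : (m < 12)%N -> psi m (diff c) = 0.
Proof. by case/psiP => wp cp; apply: pair_diff. Qed.

Lemma phi_cls i j : (i < 17)%N -> (j < 17)%N -> phi i (cls j) = (i == j)%:R.
Proof.
move=> i17 j17; have [_ _ _ wp _] := repP i17; have [wr _ _ _ _] := repP j17.
rewrite /phi pair_interp //; have /Qeq_bool_eq/qK_eq -> := iota_check (iota_check dual_check i17) j17.
by rewrite -[eqn i j]/(i == j); case: ifP; rewrite ?qK1 ?qK0.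
Qed.

(** The harmonic part: the representative of a class in the span of the h_j. *)
Definition harm c : cochain K := \sum_(j < 17) phi j c *: cls j.

Fact harm_is_linear : linear harm.
Proof.
move=> a u v; rewrite /harm scaler_sumr -big_split; apply: eq_bigr => j _.
by rewrite linearP scalerDl scalerA.
Qed.
HB.instance Definition _ :=
  GRing.isLinear.Build K (cochain K) (cochain K) *:%R harm harm_is_linear.

Lemma harm_cocycle c : diff (harm c) = 0.
Proof.
rewrite /harm lmap_sum big1 // => j _.
by rewrite lmapZ /= (cls_cocycle (ltn_ord j)) scaler0.
Qed.

Lemma harm_even c : supported even_key (harm c).
Proof.
rewrite /harm; apply: (big_ind (supported even_key)).
- exact: supported0.
- by move=> u v su sv; rewrite -[u]scale1r; apply: supportedD.
move=> j _; rewrite -[_ *: _]addr0; apply: supportedD; last exact: supported0.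
exact/cls_even.
Qed.

Lemma interp_sum_rep F : interp (sum_rep F) = \sum_(j < 17) qK (F j) *: cls j.
Proof.
rewrite -(big_mkord xpredT (fun j => qK (F j) *: cls j)) /index_iota subn0 /sum_rep.
elim: (iota 0 17) => [|j l IH] /=; first by rewrite interp_nil big_nil.
by rewrite interp_add interp_scale IH big_cons.
Qed.

Lemma wf_sum_rep F : wf (sum_rep F).
Proof.
rewrite /sum_rep; have: all (gtn 17) (iota 0 17) by [].
elim: (iota 0 17) => [|j l IH] //= /andP[j17 /IH wl].
by apply: wf_add => //; apply: wf_scale; case: (repP j17).
Qed.

Lemma interp_harm u : wf u -> harm (interp u) = interp (sum_rep (fun j => pairf (phif j) u)).
Proof.
move=> wu; rewrite interp_sum_rep; apply: eq_bigr => j _; congr (_ *: _).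
by rewrite /phi pair_interp //; case: (repP (ltn_ord j)).
Qed.

Definition project : cochain K -> cochain K := idfun \- (prim \o @diff K).
HB.instance Definition _ := GRing.Linear.on project.

Definition rest : cochain K -> cochain K := project \- (harm \o project).
HB.instance Definition _ := GRing.Linear.on rest.

Definition rest_defect : cochain K -> cochain K := rest \- (@diff K \o (prim \o rest)).
HB.instance Definition _ := GRing.Linear.on rest_defect.

Lemma rest_basis k : k \in monos -> rest (basis k) = interp (hodge_rest k) /\ wf (hodge_rest k).
Proof.
move=> km; have wz : wf (subf (mon k) (primf (fdiff k))).
  by apply: wf_sub; [apply: wf_mon | apply/wf_prim/wf_fdiff].
split; last by apply: wf_sub => //; apply: wf_sum_rep.
have pE : project (basis k) = interp (subf (mon k) (primf (fdiff k))).
  rewrite interp_sub interp_mon -interp_prim; last exact: wf_fdiff.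
  by rewrite -diff_basis.
by rewrite interp_sub -interp_harm // -pE.
Qed.

Lemma hodgeP k : k \in monos -> even_key k ->
  all (fun t => ~~ even_key t.2) (hodge_primitive k) /\
  subf (hodge_rest k) (difff (hodge_primitive k)) = [::].
Proof.
move=> km ek; have kE : k \in [seq k <- monos | even_key k] by rewrite mem_filter ek.
by have /andP[? /nilP] := allP hodge_check k kE.
Qed.

(** On an even cocycle c the map rest is c - harm c, which is therefore exact. *)
Lemma rest_exact c : supported even_key c -> rest c = diff (prim (rest c)).
Proof.
move=> ec; apply/eqP; rewrite -subr_eq0; apply/eqP.
rewrite -[LHS]/(rest_defect c); apply: linear_supported ec => k km ek.
have [rk wk] := rest_basis km; have [_ /(congr1 interp)] := hodgeP km ek.
rewrite interp_nil interp_sub -(interp_diff (wf_prim wk)) -(interp_prim wk) -rk.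
by [].
Qed.

Lemma prim_rest_odd c : supported even_key c -> supported (predC even_key) (prim (rest c)).
Proof.
apply: (linear_supports (F := prim \o rest)) => k km ek /=.
have [rk wk] := rest_basis km; have [ok _] := hodgeP km ek.
rewrite rk (interp_prim wk).
exact: supported_interp (wf_prim wk) ok.
Qed.

(** The even cohomology is spanned by the h_j, and the coordinates of the class
    of x are the phi_j(x). *)
Lemma hodge x : supported even_key x -> diff x = 0 ->
  x = harm x + diff (prim (rest x)).
Proof.
move=> ex dx; rewrite -rest_exact //.
have -> : rest x = x - harm x; last by rewrite addrC subrK.
have -> : rest x = project x - harm (project x) by [].
have -> : project x = x - prim (diff x) by [].
by rewrite dx lmap0 subr0.
Qed.

Lemma coboundary_diff b : coboundary (diff b).
Proof. by exists b. Qed.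

Lemma coboundaryD c c' : coboundary c -> coboundary c' -> coboundary (c + c').
Proof. by case=> b -> [b' ->]; exists (b + b'); rewrite lmapD. Qed.

Lemma coboundaryN c : coboundary c -> coboundary (- c).
Proof. by case=> b ->; exists (- b); rewrite lmapN. Qed.

Lemma coboundaryZ a c : coboundary c -> coboundary (a *: c).
Proof. by case=> b ->; exists (a *: b); rewrite lmapZ. Qed.

Lemma coboundary_sum (I : Type) (r : seq I) (F : I -> cochain K) :
  (forall i, coboundary (F i)) -> coboundary (\sum_(i <- r) F i).
Proof.
move=> bF; apply: (big_ind (@coboundary K)) => //; last exact: coboundaryD.
by exists 0; rewrite lmap0.
Qed.

Lemma coboundaryDr c c' : coboundary c' -> (coboundary (c + c') <-> coboundary c).
Proof.
move=> bc'; split=> [bc|bc]; last exact: coboundaryD.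
by rewrite -(addrK c' c); apply: coboundaryD => //; apply: coboundaryN.
Qed.

Lemma cohomologous_phi j c c' : (j < 17)%N -> cohomologous c c' -> phi j c = phi j c'.
Proof.
by move=> j17 [b E]; apply/eqP; rewrite -subr_eq0 -(linearB (phi j)) E /= phi_diff.
Qed.

(** The bracket of a cocycle with a coboundary is a coboundary. *)
Lemma anticomm_coboundary c b : supported even_key c -> diff c = 0 ->
  supported (predC even_key) b -> coboundary (dot c (diff b) + dot (diff b) c).
Proof.
move=> ec dc ob; rewrite leibniz // dc dot0c (lmap0 (dot b)) subr0 addr0.
exact: coboundary_diff.
Qed.

(** With x = h + db, [x, x] - [h, h] = 2 [h, db] + [db, db], and both brackets
    are brackets of an even cocycle with the coboundary db. *)
Lemma square_harm x : supported even_key x -> diff x = 0 ->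
  (coboundary (dot x x + dot x x) <-> coboundary (dot (harm x) (harm x) + dot (harm x) (harm x))).
Proof.
move=> ex dx; set h := harm x; set b := prim (rest x).
have xE : x = h + diff b by apply: hodge.
have ob : supported (predC even_key) b by apply: prim_rest_odd.
have eh : supported even_key h by apply: harm_even.
have dh : diff h = 0 by apply: harm_cocycle.
have bE : diff b = x - h by rewrite xE addrC addKr.
have edb : supported even_key (diff b).
  by rewrite bE addrC -scaleN1r; apply: supportedD.
have ddb : diff (diff b) = 0 by rewrite bE lmapB /= dx dh subr0.
have dotD (u v : cochain K) : dot (u + v) (u + v) = dot u u + (dot u v + dot v u) + dot v v.
  rewrite dotDr !dotDl !addrA; congr (_ + _).
  by rewrite -!addrA (addrC (dot v u)).
rewrite {1 2 3 4}xE dotD addrACA [X in X + _]addrACA -addrA; apply: coboundaryDr.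
apply: coboundaryD; last exact: anticomm_coboundary.
by apply: coboundaryD; apply: anticomm_coboundary.
Qed.

(** Only even p and q contribute, for which the sign (-1)^((p+1)(q+1)) is -1. *)
Lemma bracket_even x : (forall k, odd k -> hcomp k x = 0) -> bracket x x = dot x x + dot x x.
Proof.
move=> ox; have xE : x = \sum_(p < 7) hcomp p x.
  apply/ffunP => S; rewrite sum_ffunE.
  have cS : (#|S| < 7)%N by rewrite ltnS (leq_trans (max_card _)) ?card_ord.
  rewrite (sum_single (i := Ordinal cS)) ?ffunE ?eqxx // => p np.
  by rewrite ffunE eq_sym; case: eqP => // E; rewrite -val_eqE /= -E eqxx in np.
have dE c : dot c x = \sum_(q < 7) dot c (hcomp q x) by rewrite {1}xE lmap_sum.
have dotE : dot x x = \sum_(p < 7) \sum_(q < 7) dot (hcomp p x) (hcomp q x).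
  by rewrite -[LHS]/(dotr x x) {2}xE lmap_sum; apply: eq_bigr => p _; apply: dE.
rewrite {1}dotE {1}dotE [X in _ + X]exchange_big -big_split; apply: eq_bigr => p _.
rewrite -big_split; apply: eq_bigr => q _ /=.
have [op|ep] := boolP (odd p).
  by rewrite ox // dot0c (lmap0 (dot _)) scaler0 subr0 addr0.
have [oq|eq] := boolP (odd q).
  by rewrite (ox q) // dot0c (lmap0 (dot _)) scaler0 subr0 addr0.
by rewrite -signr_odd oddM /= (negPf ep) (negPf eq) expr1 scaleN1r opprK.
Qed.

Lemma odd_supported x : (forall k, odd k -> hcomp k x = 0) -> supported even_key x.
Proof.
move=> ox k; rewrite mem_monos => /subsP[ck _ _]; rewrite negbK => ok.
have := congr1 (coord k) (ox _ ok); rewrite linear0 => <-.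
by rewrite /coord ffunE cardE enum_canon ck eqxx.
Qed.

Lemma interp_square i j : (i < 17)%N -> (j < 17)%N ->
  dot (cls i) (cls j) + dot (cls j) (cls i) = interp (square i j).
Proof. by move=> /repP[? _ _ _ _] /repP[? _ _ _ _]; rewrite interp_add !interp_dot. Qed.

(** The projection that removes the component on the twelve leading classes. *)
Definition reduce c : cochain K := c - \sum_(m < 12) psi m c *: interp (lead m).

Fact reduce_is_linear : linear reduce.
Proof.
move=> a u v; rewrite /reduce scalerBr addrACA -opprD; congr (_ - _).
rewrite scaler_sumr -big_split; apply: eq_bigr => m _.
by rewrite linearP scalerDl scalerA.
Qed.
HB.instance Definition _ :=
  GRing.isLinear.Build K (cochain K) (cochain K) *:%R reduce reduce_is_linear.

Lemma square_class i j : (i < 17)%N -> (j < 17)%N ->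
  coboundary (reduce (interp (square i j))).
Proof.
move=> i17 j17; have ws := wf_square i17 j17.
have wl m : (m < 12)%N -> wf (lead m).
  move=> m12; rewrite /lead; have := iota_check quadric_small m12.
  by case: (quadric m) => [|t q] /=; [move=> _|case/andP=> /andP[t1 t2] _]; apply: wf_square.
set v := foldr (fun m v => addf (scalef (pairf (psif m) (square i j)) (lead m)) v) [::] (iota 0 12).
have [vE wv] : interp v = \sum_(m < 12) psi m (interp (square i j)) *: interp (lead m) /\ wf v.
  rewrite -(big_mkord xpredT (fun m => psi m (interp (square i j)) *: interp (lead m))).
  rewrite /index_iota subn0 /v; have: all (gtn 12) (iota 0 12) by [].
  elim: (iota 0 12) => [|m l IH] /=; first by rewrite interp_nil big_nil.
  case/andP=> m12 /IH[lE lw]; split; last by apply: wf_add => //; apply/wf_scale/wl.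
  rewrite interp_add interp_scale lE big_cons /psi pair_interp //.
  by case: (psiP m12).
have wr : wf (square_rest i j) by apply: wf_sub.
exists (interp (primf (square_rest i j))).
have /nilP/(congr1 interp) := iota_check (iota_check square_check i17) j17.
rewrite interp_nil interp_sub -interp_diff; last exact: wf_prim.
by move/eqP; rewrite subr_eq0 => /eqP <-; rewrite /reduce -vE -interp_sub.
Qed.

Lemma psi_square m i j : (m < 12)%N -> (i < 17)%N -> (j < 17)%N ->
  psi m (interp (square i j)) = \sum_(t <- quadric m) qK t.1 *
     (((i == t.2.1) && (j == t.2.2))%:R + ((i == t.2.2) && (j == t.2.1))%:R).
Proof.
move=> m12 i17 j17; have [wp _] := psiP m12.
rewrite /psi pair_interp //; last exact: wf_square.
have /Qeq_bool_eq/qK_eq -> := iota_check (iota_check (iota_check quadric_check m12) i17) j17.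
rewrite qK_sum; apply: eq_bigr => t _; rewrite qKD mulrDr.
rewrite -![eqn _ _]/(_ == _).
by congr (_ + _); do 2 case: (_ == _); rewrite ?qK0 ?mulr0 ?mulr1.
Qed.

Lemma sum_delta n (a : nat) (F : nat -> K) : (a < n)%N ->
  \sum_(i < n) (i == a :> nat)%:R * F i = F a.
Proof.
move=> an; rewrite (sum_single (i := Ordinal an)) /= ?eqxx ?mul1r // => i ni.
by rewrite -[_ == a]/(i == Ordinal an) (negPf ni) mul0r.
Qed.

Definition quadform (m : nat) (k : nat -> K) : K :=
  \sum_(t <- quadric m) qK t.1 * (k t.2.1 * k t.2.2).

Lemma square_sum (k : nat -> K) (h := \sum_(i < 17) k i *: cls i) :
  dot h h + dot h h = \sum_(i < 17) \sum_(j < 17) (k i * k j) *: interp (square i j).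
Proof.
have dr c : dot c h = \sum_(j < 17) k j *: dot c (cls j).
  by rewrite /h lmap_sum; apply: eq_bigr => j _; apply: lmapZ.
have dE : dot h h = \sum_(i < 17) \sum_(j < 17) (k i * k j) *: dot (cls i) (cls j).
  rewrite -[LHS]/(dotr h h) {2}/h lmap_sum; apply: eq_bigr => i _.
  rewrite lmapZ /= [dotr h _]dr scaler_sumr; apply: eq_bigr => j _.
  exact: scalerA.
rewrite {1}dE dE [X in _ + X]exchange_big -big_split; apply: eq_bigr => i _.
rewrite -big_split; apply: eq_bigr => j _ /=.
by rewrite [k j * _]mulrC -scalerDr interp_square.
Qed.

(** The factor 2 arises because an entry of the table stands for both orders of
    its two indices. *)
Lemma psi_square_sum m (k : nat -> K) (h := \sum_(i < 17) k i *: cls i) : (m < 12)%N ->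
  psi m (dot h h + dot h h) = 2 * quadform m k.
Proof.
move=> m12; rewrite square_sum linear_sum.
under eq_bigr => i _ do rewrite linear_sum.
under eq_bigr => i _ do under eq_bigr => j _ do rewrite linearZ /= psi_square // mulr_sumr.
under eq_bigr => i _ do rewrite exchange_big.
rewrite exchange_big /quadform mulr_sumr /=.
have := iota_check quadric_small m12.
elim: (quadric m) => [|t q IH] /=; first by rewrite !big_nil.
case/andP=> /andP[t1 t2] /IH {}IH; rewrite !big_cons {}IH; congr (_ + _).
transitivity (qK t.1 * (\sum_(i < 17) (i == t.2.1 :> nat)%:R *
    (\sum_(j < 17) (j == t.2.2 :> nat)%:R * (k i * k j))
  + \sum_(i < 17) (i == t.2.2 :> nat)%:R *
    (\sum_(j < 17) (j == t.2.1 :> nat)%:R * (k i * k j)))).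
  rewrite mulrDr !mulr_sumr -big_split; apply: eq_bigr => i _.
  rewrite !mulr_sumr -big_split; apply: eq_bigr => j _ /=.
  by rewrite -!mulnb !natrM; ring.
under eq_bigr => i _ do rewrite (sum_delta (fun j => k i * k j)) //.
rewrite (sum_delta (fun i => k i * k t.2.2)) //.
under [X in _ + X]eq_bigr => i _ do rewrite (sum_delta (fun j => k i * k j)) //.
by rewrite (sum_delta (fun i => k i * k t.2.1)) //; ring.
Qed.

(** If all psi_m([h, h]) vanish, reduce fixes [h, h]; being linear, it maps
    [h, h] to a combination of the coboundaries reduce [h_i, h_j]. *)
Lemma homologicP x : odd_elt x ->
  homologic x <-> forall m, (m < 12)%N -> quadform m (fun j => phi j x) = 0.
Proof.
case=> dx ox; have ex := odd_supported ox.
rewrite /homologic (bracket_even ox); apply: (iff_trans (square_harm ex dx)).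
set k := fun j => phi j x.
have hE : harm x = \sum_(i < 17) k i *: cls i by [].
rewrite hE; split=> [[b E] m m12|k0].
  have := psi_square_sum k m12; rewrite E psi_diff // => /esym/eqP.
  have /pcharf0P two0 := char0.
  by rewrite mulf_eq0 two0 => /eqP.
have -> : dot (harm x) (harm x) + dot (harm x) (harm x)
    = reduce (dot (harm x) (harm x) + dot (harm x) (harm x)).
  rewrite hE /reduce [X in _ = _ - X]big1 ?subr0 // => m _; rewrite psi_square_sum //.
  by rewrite k0 // mulr0 scale0r.
rewrite hE square_sum lmap_sum; apply: coboundary_sum => i.
rewrite lmap_sum; apply: coboundary_sum => j.
by rewrite lmapZ; apply/coboundaryZ/square_class.
Qed.

(** * Classes in coordinates *)

Lemma qK_neg p : qK (Zneg p # 1) = - qK (Zpos p # 1).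
Proof. exact: (qKN (Zpos p # 1)). Qed.

Lemma clsE :
  (cls 0 = h0_1) * (cls 1 = h2_1) * (cls 2 = h2_2) * (cls 3 = h2_3) *
  (cls 4 = h2_4) * (cls 5 = h2_5) * (cls 6 = h2_6) * (cls 7 = h2_7) *
  (cls 8 = h4_1) * (cls 9 = h4_2) * (cls 10 = h4_3) * (cls 11 = h4_4) *
  (cls 12 = h4_5) * (cls 13 = h4_6) * (cls 14 = h4_7) * (cls 15 = h6_1) *
  (cls 16 = h6_2).
Proof.
do !split; rewrite /cls /interp /rep /= !big_cons big_nil /basis /=;
by rewrite ?qK_neg ?scaleNr ?qK1 ?scale1r addr0 ?addrA ?qK_int.
Qed.

Lemma phiD j u v : phi j (u + v) = phi j u + phi j v.
Proof. exact: linearD. Qed.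

Lemma phiN j u : phi j (- u) = - phi j u.
Proof. exact: linearN. Qed.

Lemma phiZ j a u : phi j (a *: u) = a * phi j u.
Proof. exact: linearZ. Qed.

Lemma phi_sum j (I : Type) (r : seq I) (F : I -> cochain K) :
  phi j (\sum_(i <- r) F i) = \sum_(i <- r) phi j (F i).
Proof. exact: linear_sum. Qed.

Definition harmonic c : Prop := harm c = c.

Lemma harmonicD u v : harmonic u -> harmonic v -> harmonic (u + v).
Proof. by rewrite /harmonic lmapD /= => -> ->. Qed.

Lemma harmonicN u : harmonic u -> harmonic (- u).
Proof. by rewrite /harmonic lmapN /= => ->. Qed.

Lemma harmonicZ a u : harmonic u -> harmonic (a *: u).
Proof. by rewrite /harmonic lmapZ /= => ->. Qed.

Lemma harmonic_cls j : (j < 17)%N -> harmonic (cls j).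
Proof.
move=> j17; rewrite /harmonic /harm (sum_single (i := Ordinal j17)) => [|i ni].
  by rewrite phi_cls // eqxx scale1r.
by rewrite phi_cls // (_ : (i == j :> nat) = false) ?scale0r //; apply: negPf ni.
Qed.

Lemma cohomologous_harm x : odd_elt x -> cohomologous x (harm x).
Proof.
case=> dx /odd_supported ex; exists (prim (rest x)).
by rewrite {1}(hodge ex dx) addrC addKr.
Qed.

(** A summand y that ranges over the span of the h_j, j in J, can absorb exactly
    the coordinates of x - z with index in J, so only the others are constrained. *)
Lemma class_split (J : seq nat) x z : all (gtn 17) J -> odd_elt x -> harmonic z ->
  (exists2 y, cohomologous x (y + z) & y \in <<[seq cls j | j <- J]>>%VS) <->
  all (fun i => phi i x == phi i z) [seq i <- iota 0 17 | i \notin J].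
Proof.
move=> J17 ox hz; split=> [[y xyz yJ]|/allP E].
  apply/allP => i; rewrite mem_filter mem_iota /= => /andP[iJ i17]; apply/eqP.
  rewrite (cohomologous_phi i17 xyz) phiD -[RHS]add0r; congr (_ + _).
  rewrite (coord_span (X := in_tuple [seq cls j | j <- J]) yJ) phi_sum big1 // => l _.
  rewrite phiZ (nth_map 0%N); last by case: l => l /=; rewrite size_map.
  set j := nth _ _ _.
  have jJ : j \in J by apply: mem_nth; case: l @j => l /=; rewrite size_map.
  rewrite phi_cls //; last exact: (allP J17 j jJ).
  by case: eqP iJ => [->|_ _]; rewrite ?jJ // mulr0.
(* y + z has to represent the class of x, whose representative in the span
   of the h_j is harm x. *)
exists (harm x - z); first by rewrite subrK; apply: cohomologous_harm.
rewrite -hz -lmapB /= /harm; apply: memv_suml => j _.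
have [jJ|jJ] := boolP (val j \in J); first by apply/memvZ/memv_span/map_f.
rewrite phiD phiN; have /eqP -> : phi j x == phi j z by apply: E; rewrite mem_filter jJ mem_iota /=.
by rewrite subrr scale0r mem0v.
Qed.

Lemma degree0_check :
  all (fun j => all (fun t => ~~ nilp t.2.2) (rep j)) (iota 1 16).
Proof. by vm_cast_no_check (erefl true). Qed.

(** Nothing of degree 0 is a coboundary except 0, and h0_1 is the only h_j with a
    component in degree 0. *)
Lemma degree0_coboundary x : odd_elt x -> coboundary (hcomp 0 x) <-> phi 0 x = 0.
Proof.
move=> ox; have k0E c : phi 0 c = coord (i23, [::]) c.
  by rewrite /phi /pair /= big_seq1 qK1 mul1r.
have S0 : [set:: [::]] = set0 :> {set 'I_6} by apply/setP => i; rewrite !inE.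
split=> [[b bE]|k0].
  rewrite -(@phi_diff 0 b) // -bE !k0E /coord /= !ffunE S0 cards0 eqxx.
  by [].
exists 0; rewrite lmap0; apply: coord_inj => -[a s] sm; rewrite linear0 /coord /= ffunE.
case: eqP => [s0|_]; last by rewrite mxE.
have -> : [set:: s] = [set:: [::]] :> {set 'I_6} by rewrite S0; apply: cards0_eq.
rewrite -[LHS]/(coord (a, [::]) x) (hodge (odd_supported ox.2) ox.1) linearD /=.
rewrite [X in _ + X]/coord /= ffunE S0 !big1; first last.
- by move=> i; rewrite inE.
- by move=> i; rewrite inE.
rewrite !addr0 mxE addr0 /harm linear_sum big1 // => j _; rewrite linearZ /=.
case: j => -[|j] j17 /=; first by rewrite k0 mul0r.
have [wr _ _ _ _] := repP j17.
rewrite (supported_interp (P := fun k => ~~ nilp k.2) wr) ?mulr0 ?mem_monos //.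
by apply: (allP degree0_check); rewrite mem_iota.
Qed.

Lemma class_splits (J : seq nat) (form : cochain K -> Prop) x :
  all (gtn 17) J -> odd_elt x -> (forall z, form z -> harmonic z) ->
  (exists y z, [/\ cohomologous x (y + z), y \in <<[seq cls j | j <- J]>>%VS & form z]) <->
  (exists2 z, form z & all (fun i => phi i x == phi i z) [seq i <- iota 0 17 | i \notin J]).
Proof.
move=> J17 ox fh; split=> [[y [z [xyz yJ fz]]]|[z fz]].
  by exists z => //; apply/class_split; [| | exact: fh | exists y].
by case/(class_split J17 ox (fh z fz)) => y xyz yJ; exists y, z.
Qed.

(** * Solution of the quadratic equations *)

Definition equations (k : nat -> K) : seq K :=
  [:: k 0%N * k 1%N; k 0%N * k 7%N; k 0%N * k 8%N;
      k 0%N * k 10%N + 3 / 2 * (k 1%N * k 7%N) - 540 * (k 2%N * k 3%N);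
      k 0%N * k 11%N; k 0%N * k 12%N + 108 * (k 2%N * k 5%N);
      k 1%N * k 2%N; k 3%N * k 5%N; k 1%N * k 11%N + k 5%N * k 8%N;
      k 2%N * k 11%N; k 3%N * k 11%N; k 7%N * k 8%N].

Lemma quadformE k : [seq quadform m k | m <- iota 0 12] = equations k.
Proof.
rewrite /quadform /quadric /=; congr [:: _; _; _; _; _; _; _; _; _; _; _; _];
rewrite !big_cons big_nil /= ?qK1 ?mul1r addr0 //; rewrite ?addrA ?qK_neg ?mulNr ?qK_int;
by [].
Qed.

Lemma homologic_equations x : odd_elt x ->
  homologic x <-> all (eq_op^~ 0) (equations (fun j => phi j x)).
Proof.
move=> ox; rewrite -quadformE all_map; apply: (iff_trans (homologicP ox)).
split=> [E|/iota_check E m m12]; last exact/eqP/E.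
by apply/allP => m; rewrite mem_iota /= => m12; apply/eqP/E.
Qed.

Definition form_zero (z : cochain K) : Prop :=
  (exists k21 k25 k41 k44 : K,
     k21 * k44 + k25 * k41 = 0 /\
     z = k21 *: h2_1 + k25 *: h2_5 + k41 *: h4_1 + k44 *: h4_4) \/
  (exists k22 k41 : K, z = k22 *: h2_2 + k41 *: h4_1) \/
  (exists k22 k27 : K, z = k22 *: h2_2 + k27 *: h2_7) \/
  (exists k23 k27 : K, z = k23 *: h2_3 + k27 *: h2_7) \/
  (exists k21 k23 k41 : K, z = k21 *: h2_1 + k23 *: h2_3 + k41 *: h4_1) \/
  (exists k25 k27 k44 : K, z = k25 *: h2_5 + k27 *: h2_7 + k44 *: h4_4).

Definition form_nonzero (z : cochain K) : Prop :=
  exists alpha beta gamma : K,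
    alpha != 0 /\
    (z = alpha *: h0_1 + beta *: h2_2
         + gamma *: (h2_3 + (540 * (beta / alpha)) *: h4_3) \/
     z = alpha *: h0_1 + beta *: h2_2
         + gamma *: (h2_5 - (108 * (beta / alpha)) *: h4_5)).

Ltac harmonic_tac := repeat first
  [ exact: harmonic_cls | apply: harmonicD | apply: harmonicN | apply: harmonicZ ].

Lemma form_zero_harmonic z : form_zero z -> harmonic z.
Proof.
rewrite /form_zero -!clsE.
by case=> [[a [b [c [d [_ ->]]]]]|[[a [b ->]]|[[a [b ->]]|[[a [b ->]]
  |[[a [b [c ->]]]|[a [b [c ->]]]]]]]]; harmonic_tac.
Qed.

Lemma form_nonzero_harmonic z : form_nonzero z -> harmonic z.
Proof.
rewrite /form_nonzero -!clsE.
by case=> a [b [c [_ [->|->]]]]; harmonic_tac.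
Qed.

Definition phi_simp := (phiD, phiN, phiZ, phi_cls).
Definition K_simp := (mulr0, mulr1, addr0, add0r, oppr0).

(** When k_0 (the coefficient of h0_1) is nonzero, the equations give
    k_1 = k_7 = k_8 = k_11 = 0, determine k_10 and k_12, and leave
    k_3 k_5 = 0.  When it is 0, the cases are distinguished by which of
    k_2, k_7 and k_3 vanish.  The indices absorbed by y are those that occur
    in no remaining equation. *)
Lemma classification x : odd_elt x ->
  homologic x <->
  (coboundary (hcomp 0 x) /\
   exists y z, [/\ cohomologous x (y + z),
     y \in <<[:: h2_4; h2_6; h4_2; h4_3; h4_5; h4_6; h4_7; h6_1; h6_2]>>%VS & form_zero z]) \/
  (~ coboundary (hcomp 0 x) /\
   exists y z, [/\ cohomologous x (y + z),
     y \in <<[:: h2_4; h2_6; h4_2; h4_6; h4_7; h6_1; h6_2]>>%VS & form_nonzero z]).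
Proof.
move=> ox.
have span_zero : [:: h2_4; h2_6; h4_2; h4_3; h4_5; h4_6; h4_7; h6_1; h6_2]
    = [seq cls j | j <- [:: 4; 6; 9; 10; 12; 13; 14; 15; 16]%N] by rewrite /= !clsE.
have span_nonzero : [:: h2_4; h2_6; h4_2; h4_6; h4_7; h6_1; h6_2]
    = [seq cls j | j <- [:: 4; 6; 9; 13; 14; 15; 16]%N] by rewrite /= !clsE.
rewrite span_zero span_nonzero.
have split_zero := @class_splits [:: 4; 6; 9; 10; 12; 13; 14; 15; 16]%N form_zero x isT ox form_zero_harmonic.
have split_nonzero := @class_splits [:: 4; 6; 9; 13; 14; 15; 16]%N form_nonzero x isT ox form_nonzero_harmonic.
have c0 := degree0_coboundary ox.
apply: (iff_trans (homologic_equations ox)).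
have nz n : n.+1%:R != 0 :> K by have /pcharf0P -> := char0.
have div0 (a b : K) : a * b = 0 -> a != 0 -> b = 0.
  by move=> /eqP; rewrite mulf_eq0 => /orP[/eqP->|/eqP//]; rewrite eqxx.
split.
  rewrite /equations /=.
  case/andP=> /eqP e1 /andP[/eqP e2 /andP[/eqP e3 /andP[/eqP e4 /andP[/eqP e5 /andP[/eqP e6
    /andP[/eqP e7 /andP[/eqP e8 /andP[/eqP e9 /andP[/eqP e10 /andP[/eqP e11 /andP[/eqP e12 _]]]]]]]]]]].
  have [k0|k0] := eqVneq (phi 0 x) 0.
    left; split; first exact/c0.
    apply/split_zero; rewrite /form_zero -!clsE.
    rewrite k0 !mul0r !add0r in e4 e6; have {}e6 := div0 _ _ e6 (nz _).
    have [k2|k2] := eqVneq (phi 2 x) 0.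
      rewrite k2 mul0r mulr0 subr0 in e4.
      have {}e4 := div0 _ _ e4 (mulf_neq0 (nz 2) (invr_neq0 (nz 1))).
      have [k7|k7] := eqVneq (phi 7 x) 0.
        have [k3|k3] := eqVneq (phi 3 x) 0.
          exists (phi 1 x *: cls 1 + phi 5 x *: cls 5 + phi 8 x *: cls 8 + phi 11 x *: cls 11).
            by left; exists (phi 1 x), (phi 5 x), (phi 8 x), (phi 11 x).
          by rewrite /= !phi_simp //= !K_simp k0 k2 k3 k7 !eqxx.
        have k5 := div0 _ _ e8 k3; have k11 := div0 _ _ e11 k3.
        exists (phi 1 x *: cls 1 + phi 3 x *: cls 3 + phi 8 x *: cls 8).
          by do 4 right; left; exists (phi 1 x), (phi 3 x), (phi 8 x).
        by rewrite /= !phi_simp //= !K_simp k0 k2 k5 k7 k11 !eqxx.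
      have k8 := div0 _ _ e12 k7.
      have k1 : phi 1 x = 0 by apply: div0 k7; rewrite mulrC.
      have [k3|k3] := eqVneq (phi 3 x) 0.
        exists (phi 5 x *: cls 5 + phi 7 x *: cls 7 + phi 11 x *: cls 11).
          by do 5 right; exists (phi 5 x), (phi 7 x), (phi 11 x).
        by rewrite /= !phi_simp //= !K_simp k0 k1 k2 k3 k8 !eqxx.
      have k5 := div0 _ _ e8 k3; have k11 := div0 _ _ e11 k3.
      exists (phi 3 x *: cls 3 + phi 7 x *: cls 7).
        by do 3 right; left; exists (phi 3 x), (phi 7 x).
      by rewrite /= !phi_simp //= !K_simp k0 k1 k2 k5 k8 k11 !eqxx.
    have k5 := div0 _ _ e6 k2; have k11 := div0 _ _ e10 k2.
    have k1 : phi 1 x = 0 by apply: div0 k2; rewrite mulrC.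
    have k3 : phi 3 x = 0.
      move/eqP: e4; rewrite k1 mul0r mulr0 sub0r oppr_eq0 => /eqP e4.
      by apply: (div0 _ _ _ k2); apply: (div0 _ _ e4 (nz _)).
    have [k7|k7] := eqVneq (phi 7 x) 0.
      exists (phi 2 x *: cls 2 + phi 8 x *: cls 8).
        by right; left; exists (phi 2 x), (phi 8 x).
      by rewrite /= !phi_simp //= !K_simp k0 k1 k3 k5 k7 k11 !eqxx.
    have k8 := div0 _ _ e12 k7.
    exists (phi 2 x *: cls 2 + phi 7 x *: cls 7).
      by do 2 right; left; exists (phi 2 x), (phi 7 x).
    by rewrite /= !phi_simp //= !K_simp k0 k1 k3 k5 k8 k11 !eqxx.
  right; split; first by move/c0/eqP; apply/negP.
  apply/split_nonzero; rewrite /form_nonzero -!clsE.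
  have k1 := div0 _ _ e1 k0; have k7 := div0 _ _ e2 k0; have k8 := div0 _ _ e3 k0.
  have k11 := div0 _ _ e5 k0.
  have k10 : phi 10 x = phi 3 x * (540 * (phi 2 x / phi 0 x)).
    apply: (mulfI k0); apply/eqP; rewrite -subr_eq0; apply/eqP; rewrite -[RHS]e4 k1.
    field.  by rewrite k0 (nz 1).
  have k12 : phi 12 x = - (phi 5 x * (108 * (phi 2 x / phi 0 x))).
    apply: (mulfI k0); apply/eqP; rewrite -subr_eq0; apply/eqP; rewrite -[RHS]e6.
    field.  by rewrite k0.
  have [k3|k3] := eqVneq (phi 3 x) 0.
    exists (phi 0 x *: cls 0 + phi 2 x *: cls 2
            + phi 5 x *: (cls 5 - (108 * (phi 2 x / phi 0 x)) *: cls 12)).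
      by exists (phi 0 x), (phi 2 x), (phi 5 x); split=> //; right.
    by rewrite /= !phi_simp //= !K_simp k1 k3 k7 k8 k10 k11 k12 k3 mul0r mulrN !eqxx.
  have k5 := div0 _ _ e8 k3.
  exists (phi 0 x *: cls 0 + phi 2 x *: cls 2
          + phi 3 x *: (cls 3 + (540 * (phi 2 x / phi 0 x)) *: cls 10)).
    by exists (phi 0 x), (phi 2 x), (phi 3 x); split=> //; left.
  by rewrite /= !phi_simp //= !K_simp k1 k5 k7 k8 k10 k11 k12 k5 mul0r oppr0 !eqxx.
case=> [[/c0 k0 /split_zero[z]]|[_ /split_nonzero[z]]].
  rewrite /form_zero -!clsE /equations /=.
  case=> [[a [b [c [d [abcd ->]]]]]|[[a [b ->]]|[[a [b ->]]|[[a [b ->]]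
    |[[a [b [c ->]]]|[a [b [c ->]]]]]]]]; rewrite !phi_simp //= !K_simp;
  case/andP=> _ /andP[/eqP-> /andP[/eqP-> /andP[/eqP-> /andP[/eqP-> /andP[/eqP-> /andP[/eqP->
    /andP[/eqP-> _]]]]]]]; rewrite k0 !mul0r !mulr0 ?abcd ?(mul0r, mulr0, addr0, subr0) ?eqxx //=.
rewrite /form_nonzero -!clsE /equations /=.
case=> a [b [c [a0 [->|->]]]]; rewrite !phi_simp //= !K_simp;
case/andP=> /eqP-> /andP[/eqP-> /andP[/eqP-> /andP[/eqP-> /andP[/eqP-> /andP[/eqP-> /andP[/eqP->
    /andP[/eqP-> /andP[/eqP-> /andP[/eqP-> _]]]]]]]]].
  by rewrite andbT; do ?(apply/andP; split); apply/eqP; try ring; field; rewrite a0 (nz 1).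
by rewrite andbT; do ?(apply/andP; split); apply/eqP; try ring; field; rewrite a0.
Qed.

End Cohomology.

Theorem mainTheorem7 (R : realType) (x : cochain R[i]) (x_odd : odd_elt x) :
  homologic x <->
  (coboundary (hcomp 0 x) /\
   exists y z : cochain R[i],
     [/\ cohomologous x (y + z),
         y \in <<[:: h2_4; h2_6; h4_2; h4_3; h4_5; h4_6; h4_7; h6_1; h6_2]>>%VS
       & (exists k21 k25 k41 k44 : R[i],
            k21 * k44 + k25 * k41 = 0 /\
            z = k21 *: h2_1 + k25 *: h2_5 + k41 *: h4_1 + k44 *: h4_4) \/
         (exists k22 k41 : R[i], z = k22 *: h2_2 + k41 *: h4_1) \/
         (exists k22 k27 : R[i], z = k22 *: h2_2 + k27 *: h2_7) \/
         (exists k23 k27 : R[i], z = k23 *: h2_3 + k27 *: h2_7) \/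
         (exists k21 k23 k41 : R[i],
            z = k21 *: h2_1 + k23 *: h2_3 + k41 *: h4_1) \/
         (exists k25 k27 k44 : R[i],
            z = k25 *: h2_5 + k27 *: h2_7 + k44 *: h4_4)])
  \/
  (~ coboundary (hcomp 0 x) /\
   exists y z : cochain R[i],
     [/\ cohomologous x (y + z),
         y \in <<[:: h2_4; h2_6; h4_2; h4_6; h4_7; h6_1; h6_2]>>%VS
       & exists alpha beta gamma : R[i],
           alpha != 0 /\
           (z = alpha *: h0_1 + beta *: h2_2
                + gamma *: (h2_3 + (540 * (beta / alpha)) *: h4_3) \/
            z = alpha *: h0_1 + beta *: h2_2
                + gamma *: (h2_5 - (108 * (beta / alpha)) *: h4_5))]).
Proof. exact: (classification (pchar_num _) x_odd). Qed.
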